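(* Let $d\ge1$ be an integer, let $G$ be a planar graph and let $\mathcal{M}$ be a $d$-clique lift of $G$. Then $G^{\mathcal{M}}$ is contained in $H\boxtimes P\boxtimes K_{27(d+1)}$ for some graph $H$ with treewidth at most $19$ and some path $P$, and thus $\mathrm{rtw}(G^{\mathcal{M}})\le 540(d+1)-1$.
   Context: Graphs are finite, simple, undirected. For a graph $G$ and integer $d\ge1$, a $d$-clique lift of $G$ is a family $\mathcal{M}=\{M_v: v\in V(G)\}$ with $M_v\subseteq N_G(v)$ and $|M_v|\le d$ for each $v$; $G^{\mathcal{M}}$ is the graph obtained from $G$ by adding the edge $uw$ (for distinct $u,w$) whenever there is $v\in V(G)$ with $u\in M_v$ and $w\in N_G(v)$. Contained means isomorphic to a subgraph. The strong product $G_1\boxtimes G_2$ has vertex set $V(G_1)\times V(G_2)$ with distinct $(a,v),(b,u)$ adjacent iff ($a=b$ or $ab\in E(G_1)$) and ($u=v$ or $uv\in E(G_2)$). The row treewidth $\mathrm{rtw}(G)$ is the minimum treewidth of a graph $H'$ such that $G$ is contained in $H'\boxtimes P'$ for some path $P'$. *)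

(* Defs.v *)
From mathcomp Require Import all_boot.
From Stdlib Require Import Reals.

Unset Printing Implicit Defensive.

Record sgraph := SGraph {
  vertex :> finType;
  adj : rel vertex;
  adj_sym : symmetric adj;
  adj_irr : irreflexive adj }.

Arguments adj {s}.

Definition sprod_rel (G1 G2 : sgraph) : rel (G1 * G2)%type :=
  fun x y => (x != y) && ((x.1 == y.1) || adj x.1 y.1)
                      && ((x.2 == y.2) || adj x.2 y.2).

Lemma sprod_sym G1 G2 : symmetric (sprod_rel G1 G2).
Proof.
move=> x y; rewrite /sprod_rel eq_sym (eq_sym x.1) (eq_sym x.2).
by rewrite (adj_sym G1) (adj_sym G2).
Qed.

Lemma sprod_irr G1 G2 : irreflexive (sprod_rel G1 G2).
Proof. by move=> x; rewrite /sprod_rel eqxx. Qed.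

Definition sprod (G1 G2 : sgraph) : sgraph :=
  @SGraph (G1 * G2)%type (sprod_rel G1 G2) (sprod_sym G1 G2) (sprod_irr G1 G2).

Definition path_rel n : rel 'I_n := fun i j => (i.+1 == j) || (j.+1 == i).
Lemma path_sym n : symmetric (path_rel n).
Proof. by move=> i j; rewrite /path_rel orbC. Qed.
Lemma path_irr n : irreflexive (path_rel n).
Proof. by move=> i; rewrite /path_rel orbb (gtn_eqF (ltnSn i)). Qed.
Definition path_graph n : sgraph := @SGraph (ordinal n) (path_rel n) (path_sym n) (path_irr n).

Definition complete_rel n : rel 'I_n := fun i j => i != j.
Lemma complete_sym n : symmetric (complete_rel n).
Proof. by move=> i j; rewrite /complete_rel eq_sym. Qed.
Lemma complete_irr n : irreflexive (complete_rel n).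
Proof. by move=> i; rewrite /complete_rel eqxx. Qed.
Definition complete_graph n : sgraph :=
  @SGraph (ordinal n) (complete_rel n) (complete_sym n) (complete_irr n).

Definition contained (G H : sgraph) : Prop :=
  exists f : G -> H, injective f /\ forall x y, adj x y -> adj (f x) (f y).

Definition is_tree (T : sgraph) : Prop :=
  (exists t : T, True) /\
  (forall x y : T, connect (@adj T) x y) /\
  (forall s : seq T, uniq s -> 2 < size s -> ~~ cycle (@adj T) s).

Definition tw_le (G : sgraph) (k : nat) : Prop :=
  exists (T : sgraph) (B : T -> {set G}),
    is_tree T /\
    (forall v : G, exists t, v \in B t) /\
    (forall u v : G, adj u v -> exists t, (u \in B t) /\ (v \in B t)) /\
    (forall (v : G) (t1 t2 : T), v \in B t1 -> v \in B t2 ->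
        connect (fun a b => [&& adj a b, v \in B a & v \in B b]) t1 t2) /\
    (forall t, #|B t| <= k.+1).

Definition rtw_le (G : sgraph) (k : nat) : Prop :=
  exists (H : sgraph) (n : nat), tw_le H k /\ contained G (sprod H (path_graph n)).

Definition nbhd (G : sgraph) (v : G) : {set G} := [set u | adj v u].

Definition clique_lift (G : sgraph) (d : nat) (M : G -> {set G}) : Prop :=
  forall v : G, M v \subset nbhd G v /\ #|M v| <= d.

Definition lift_rel (G : sgraph) (M : G -> {set G}) : rel G :=
  fun u w => (u != w) && (adj u w ||
     [exists v, ((u \in M v) && adj v w) || ((w \in M v) && adj v u)]).

Lemma lift_sym G M : symmetric (lift_rel G M).
Proof.
move=> u w; rewrite /lift_rel eq_sym (adj_sym G); congr (_ && (_ || _)).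
by apply/existsP/existsP => -[v Hv]; exists v; rewrite orbC.
Qed.
Lemma lift_irr G M : irreflexive (lift_rel G M).
Proof. by move=> u; rewrite /lift_rel eqxx. Qed.
Definition lift_graph (G : sgraph) (M : G -> {set G}) : sgraph :=
  @SGraph G (lift_rel G M) (lift_sym G M) (lift_irr G M).

(** Planarity: a drawing in the real plane R^2. Vertices are distinct points;
    each edge uw is an arc (continuous, injective on [0,1]) from the point of
    u to the point of w whose interior avoids all vertex points, and arcs of
    distinct edges meet only in a common endpoint. Curves are given for
    ordered adjacent pairs (cx u w, cy u w) : R -> R*R, restricted to [0,1]. *)
Definition planar (G : sgraph) : Prop :=
  exists (px py : G -> R) (cx cy : G -> G -> R -> R),
    (forall u v : G, px u = px v -> py u = py v -> u = v) /\
    (forall u w : G, adj u w ->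
       continuity (cx u w) /\ continuity (cy u w) /\
       cx u w 0%R = px u /\ cy u w 0%R = py u /\
       cx u w 1%R = px w /\ cy u w 1%R = py w /\
       (forall s t : R, (0 <= s <= 1)%R -> (0 <= t <= 1)%R ->
          cx u w s = cx u w t -> cy u w s = cy u w t -> s = t) /\
       (forall (s : R) (z : G), (0 < s < 1)%R ->
          ~ (cx u w s = px z /\ cy u w s = py z))) /\
    (forall u w x y : G, adj u w -> adj x y ->
       ~ (u = x /\ w = y) -> ~ (u = y /\ w = x) ->
       forall s t : R, (0 <= s <= 1)%R -> (0 <= t <= 1)%R ->
         cx u w s = cx x y t -> cy u w s = cy x y t ->
         exists z : G, (z = u \/ z = w) /\ (z = x \/ z = y) /\
                       cx u w s = px z /\ cy u w s = py z).

(* Main.v *)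
(** The drawing is first made discrete. Split every arc at its middle and give each half to
    its endpoint; halves with different owners are disjoint compact sets, so on a fine
    grid they become disjoint connected sets of cells, and [G] is a minor of a grid. The
    Jordan curve theorem is never used: the only planarity input is that the grid has
    trivial first cohomology over F_2. By a rank count it follows that whenever
    the grid is partitioned into four connected pairwise touching sets, exactly one
    triangle meets a given three of them.

    This suffices for the product structure theorem (treewidth 3, at most 3 vertices per
    part and BFS layer). Parts are unions of at most three vertical paths of
    a BFS tree, and every component [C] of the remaining vertices touches at most three
    earlier parts, pairwise touching. Colour [C] by the part its vertical paths end in: by
    parity some trichromatic triangle meets [C], and its three vertical paths form
    the next part; no component left in [C] touches all three old parts.

    For the lift, put [w] in the earliest part met by [w] and the [v] with [w] in [M v], and
    merge layers in pairs. Adjacent vertices of the lift then lie in parts that are both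
    reachable from a common part by at most three descents to parents, and a part
    reaches at most 'C(6, 3) = 20 parts in three descents. *)

From Stdlib Require Import Reals Lra Lia ClassicalEpsilon.
Require Import Defs.
From mathcomp Require Import all_boot zify.

Set Implicit Arguments.
Unset Strict Implicit.

(** * Discretising a drawing *)

Local Open Scope R_scope.

(** The parts seen by a component are kept pairwise touching because the triangle count needs four
    pairwise touching classes, here three parts and one component. Moving [w] to an earlier part
    answers the following obstacle. If [u] and [w] are neighbours of [v] in parts later than that of
    [v], no single part need reach both of them by descents. Once [w] sits no later than [v], it is
    reached from [u] by way of [v]. An edge of the lift spans at most two layers, whereas a path
    joins consecutive vertices only; this is why layers are merged in pairs. Constants: bags of 20
    parts give treewidth 19. One part and one pair of layers receive at most 3 * 4 * (d + 1)
    vertices, which is within 27(d + 1), and 540 = 20 * 27. *)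

Lemma finite_uniform (I : finType) (P : I -> nat -> Prop) :
  (forall i n n', (n <= n')%N -> P i n -> P i n') -> (forall i, exists n, P i n) ->
  exists n, forall i, P i n.
Proof.
move=> Pmono exP.
suff [n nP] : exists n, forall i, i \in enum I -> P i n.
  by exists n => i; apply: nP; rewrite mem_enum.
elim: (enum I) => [|i s [n IH]]; first by exists 0%N.
have [k Pk] := exP i; exists (maxn k n) => j; rewrite inE => /orP[/eqP->|js].
  exact: Pmono (leq_maxl _ _) Pk.
exact: Pmono (leq_maxr _ _) (IH j js).
Qed.

Lemma continuity_dist (f : R -> R) s eps : continuity f -> 0 < eps ->
  exists d, 0 < d /\ forall t, Rabs (t - s) < d -> Rabs (f t - f s) < eps.
Proof.
move=> cf e0; have [d [d0 h]] := cf s eps e0; exists d; split=> // t td.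
have [->|ne] := Req_dec t s; first by rewrite Rminus_diag Rabs_R0.
by apply: (h t); split=> //; split=> // E; apply: ne.
Qed.

(** The extreme value theorem in one variable is used twice. For fixed [s] the l1 distance to the
    second arc has a minimiser [tm s]; the minimum [F s] varies by no more than the first arc moves,
    so [F] is continuous and attains its minimum, which is positive by disjointness. *)
Lemma arcs_apart (f1 f2 g1 g2 : R -> R) a b c d :
  continuity f1 -> continuity f2 -> continuity g1 -> continuity g2 ->
  a <= b -> c <= d ->
  (forall s t, a <= s <= b -> c <= t <= d -> ~ (f1 s = g1 t /\ f2 s = g2 t)) ->
  exists n : nat, forall s t, a <= s <= b -> c <= t <= d ->
    ~ (Rabs (f1 s - g1 t) < / INR n.+1 /\ Rabs (f2 s - g2 t) < / INR n.+1).
Proof.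
move=> cf1 cf2 cg1 cg2 ab cd dis.
pose D s t := Rabs (f1 s - g1 t) + Rabs (f2 s - g2 t).
have exmin s : exists t0, c <= t0 <= d /\ forall t, c <= t <= d -> D s t0 <= D s t.
  have cD : continuity (D s).
    have h (f g : R -> R) : continuity g -> continuity (fun t => Rabs (f s - g t)).
      move=> cg; apply: (continuity_comp (fun t => f s - g t) Rabs); last exact: Rcontinuity_abs.
      by apply: continuity_minus => //; apply: continuity_const => x y.
    by apply: continuity_plus; apply: h.
  have [t0 [h1 h2]] := continuity_ab_min (D s) c d cd (fun x _ => cD x).
  by exists t0.
pose tm s := proj1_sig (constructive_indefinite_description _ (exmin s)).
have tmP s : c <= tm s <= d /\ forall t, c <= t <= d -> D s (tm s) <= D s t.
  exact: (proj2_sig (constructive_indefinite_description _ (exmin s))).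
pose F s := D s (tm s).
have FD s t : F t <= F s + (Rabs (f1 t - f1 s) + Rabs (f2 t - f2 s)).
  have [_ h] := tmP t; have [h1 _] := tmP s; have := h _ h1.
  rewrite -/(F t) /F /D => le.
  have := Rabs_triang (f1 t - f1 s) (f1 s - g1 (tm s)).
  have := Rabs_triang (f2 t - f2 s) (f2 s - g2 (tm s)).
  have -> : f1 t - f1 s + (f1 s - g1 (tm s)) = f1 t - g1 (tm s) by ring.
  have -> : f2 t - f2 s + (f2 s - g2 (tm s)) = f2 t - g2 (tm s) by ring.
  lra.
have cF : continuity F.
  move=> s eps e0.
  have [d1 [d10 h1]] := @continuity_dist f1 s (eps / 2) cf1 ltac:(lra).
  have [d2 [d20 h2]] := @continuity_dist f2 s (eps / 2) cf2 ltac:(lra).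
  exists (Rmin d1 d2); split; first exact: Rmin_pos.
  move=> t [_]; rewrite /= /Rdist => td.
  have lt1 := h1 t (Rlt_le_trans _ _ _ td (Rmin_l _ _)).
  have lt2 := h2 t (Rlt_le_trans _ _ _ td (Rmin_r _ _)).
  have := FD s t; have := FD t s.
  rewrite (Rabs_minus_sym (f1 s)) (Rabs_minus_sym (f2 s)) => ? ?.
  by apply: Rabs_def1; lra.
have [s0 [smin s0ab]] := continuity_ab_min F a b ab (fun x _ => cF x).
have Fpos : 0 < F s0.
  have [tcd _] := tmP s0; have := dis s0 _ s0ab tcd.
  rewrite /F /D; have := Rabs_pos (f1 s0 - g1 (tm s0)); have := Rabs_pos (f2 s0 - g2 (tm s0)).
  move=> p2 p1 ne; apply: Rnot_le_lt => le; apply: ne.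
  have z1 : Rabs (f1 s0 - g1 (tm s0)) = 0 by lra.
  have z2 : Rabs (f2 s0 - g2 (tm s0)) = 0 by lra.
  by split; move: z1 z2; split_Rabs; lra.
have [N [Nlt N0]] := archimed_cor1 (F s0 / 2) ltac:(lra).
exists N => s t sab tcd [l1 l2].
have := smin s sab; have [_ /(_ t tcd)] := tmP s; rewrite -/(F s) /D.
have : / INR N.+1 <= / INR N.
  apply: Rinv_le_contravar; first by apply: lt_0_INR.
  by rewrite S_INR; lra.
lra.
Qed.

Lemma uniform_arc (f : R -> R) eps : continuity f -> 0 < eps ->
  exists n : nat, forall s t, 0 <= s <= 1 -> 0 <= t <= 1 ->
    Rabs (s - t) <= / INR n.+1 -> Rabs (f s - f t) < eps.
Proof.
move=> cf e0.
have [d h] := Heine_cor2 (a := 0) (b := 1) (f := f) (fun x _ => cf x) (mkposreal eps e0).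
have [N [Nlt N0]] := archimed_cor1 d (cond_pos d).
exists N => s t s01 t01 st; apply: h => //.
apply: Rle_lt_trans st _; apply: Rle_lt_trans Nlt.
apply: Rinv_le_contravar; first by apply: lt_0_INR.
by rewrite S_INR; lra.
Qed.

(** [up r] is the integer above [r] and at most [r + 1], so it numbers the unit cells of the line.
    This lemma and the next translate between cells and distances. *)
Lemma up_close (u v : R) : Rabs (u - v) < 1 -> (up u <= up v + 1)%Z.
Proof.
move=> uv; have := Rabs_def2 _ _ uv; have [h1 h2] := archimed u; have [h3 h4] := archimed v.
move=> [h5 h6]; suff : (up u < up v + 2)%Z by lia.
by apply: lt_IZR; rewrite plus_IZR; lra.
Qed.

Lemma up_eq_close (u v : R) : up u = up v -> Rabs (u - v) < 1.
Proof.
move=> E; have [h1 h2] := archimed u; have [h3 h4] := archimed v; rewrite E in h1 h2.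
by apply: Rabs_def1; lra.
Qed.

(** Only one of the two curves of an edge is kept, as a drawing does not make them reverses of each
    other. A pair [(x, x)] stands for the constant arc at the point of [x], so isolated vertices
    need no separate treatment. *)
Definition oriented (G : sgraph) (x y : G) :=
  (x == y) || (adj x y && (enum_rank x < enum_rank y)%N).
(* The half arcs of [(x, y)]: the first half belongs to [x], the second to [y]. *)
Definition owner (G : sgraph) (p : G * G * bool) := if p.2 then p.1.2 else p.1.1.
Definition in_half h (s : bool) k := (if s then h <= k <= h.*2 else k <= h)%N.

Definition half_time (s : bool) (t : R) := if s then 1 / 2 <= t <= 1 else 0 <= t <= 1 / 2.

Section Drawing.
Variables (G : sgraph) (px py : G -> R) (cx cy : G -> G -> R -> R).
Hypothesis p_inj : forall u v : G, px u = px v -> py u = py v -> u = v.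
Hypothesis arcs : forall u w : G, adj u w ->
       continuity (cx u w) /\ continuity (cy u w) /\
       cx u w 0 = px u /\ cy u w 0 = py u /\
       cx u w 1 = px w /\ cy u w 1 = py w /\
       (forall s t : R, (0 <= s <= 1) -> (0 <= t <= 1) ->
          cx u w s = cx u w t -> cy u w s = cy u w t -> s = t) /\
       (forall (s : R) (z : G), (0 < s < 1) ->
          ~ (cx u w s = px z /\ cy u w s = py z)).
Hypothesis crossings : forall u w x y : G, adj u w -> adj x y ->
       ~ (u = x /\ w = y) -> ~ (u = y /\ w = x) ->
       forall s t : R, (0 <= s <= 1) -> (0 <= t <= 1) ->
         cx u w s = cx x y t -> cy u w s = cy x y t ->
         exists z : G, (z = u \/ z = w) /\ (z = x \/ z = y) /\
                       cx u w s = px z /\ cy u w s = py z.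

Definition fx x y t := if x == y then px x else cx x y t.
Definition fy x y t := if x == y then py x else cy x y t.

Lemma f_cont x y : oriented x y -> continuity (fx x y) /\ continuity (fy x y).
Proof.
rewrite /oriented /fx /fy; case: eqP => [->|_ /= /andP[/arcs[? [? _]] _]] //.
by split; apply: continuity_const => ? ?.
Qed.

Lemma f_ends x y : oriented x y ->
  [/\ fx x y 0 = px x, fy x y 0 = py x, fx x y 1 = px y & fy x y 1 = py y].
Proof.
rewrite /oriented /fx /fy; case: eqP => [->|_ /= /andP[/arcs[_ [_ [? [? [? [? _]]]]]] _]] //.
Qed.

Lemma half_time01 s t : half_time s t -> 0 <= t <= 1.
Proof. by case: s => /=; lra. Qed.

(** The interior of an arc avoids all vertex points, so the point is an end of the arc; time 0
    occurs only in the first half and time 1 only in the second, and the owner of the half is that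
    very end. *)
Lemma at_vertex x y s t z : oriented x y -> half_time s t ->
  fx x y t = px z -> fy x y t = py z -> owner (x, y, s) = z.
Proof.
rewrite /oriented /fx /fy /owner /=; case: eqP => [<- _ _ h1 h2|_ /= /andP[/arcs A _]].
  by case: s; apply: p_inj.
case: A => _ [_ [x0 [y0 [x1 [y1 [_ inner]]]]]] st h1 h2.
have t01 := half_time01 st.
have [t0|t0] := Req_dec t 0.
  rewrite t0 x0 y0 in h1 h2; case: s st => /= [|_]; first by lra.
  exact: p_inj.
have [t1|t1] := Req_dec t 1.
  rewrite t1 x1 y1 in h1 h2; case: s st => /= [_|]; last by lra.
  exact: p_inj.
by case: (inner t z) => //; lra.
Qed.

(** A common point of two arcs is a vertex point, and then both owners equal that vertex. The halves
    of a single arc share its midpoint, hence the condition [p.1 != p'.1]; they are separated later,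
    on the grid. *)
Lemma halves_disjoint (p p' : G * G * bool) s t :
  oriented p.1.1 p.1.2 -> oriented p'.1.1 p'.1.2 -> owner p != owner p' -> p.1 != p'.1 ->
  half_time p.2 s -> half_time p'.2 t ->
  ~ (fx p.1.1 p.1.2 s = fx p'.1.1 p'.1.2 t /\ fy p.1.1 p.1.2 s = fy p'.1.1 p'.1.2 t).
Proof.
case: p p' => [[x y] b] [[x' y'] b'] /= o o' ne ne1 hs ht [ex ey].
have [E|xy] := eqVneq x y.
  have := at_vertex (z := x) o' ht; rewrite -ex -ey /fx /fy E eqxx => /(_ erefl erefl) E'.
  by move: ne; rewrite E' /owner /= E; case: b {hs}; rewrite eqxx.
have [E|xy'] := eqVneq x' y'.
  have := at_vertex (z := x') o hs; rewrite ex ey /fx /fy E eqxx => /(_ erefl erefl) E'.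
  by move: ne; rewrite E' /owner /= E; case: b' {ht}; rewrite eqxx.
have := o; have := o'; rewrite {1 2}/oriented (negPf xy) (negPf xy') /= => /andP[a' r']
    /andP[a r].
have [||||z [_ [_ [zx zy]]]] := crossings a a' _ _ (half_time01 hs) (half_time01 ht).
- by case=> e1 e2; rewrite e1 e2 eqxx in ne1.
- by case=> e1 e2; move: r; rewrite e1 e2 ltnNge ltnW.
- by move: ex; rewrite /fx (negPf xy) (negPf xy').
- by move: ey; rewrite /fy (negPf xy) (negPf xy').
have fxz : fx x y s = px z by rewrite /fx (negPf xy).
have fyz : fy x y s = py z by rewrite /fy (negPf xy).
case/eqP: ne; rewrite (at_vertex o hs fxz fyz); symmetry.
by apply: (at_vertex o' ht); rewrite -?ex -?ey.
Qed.
End Drawing.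

(** [X] and [Y] are the cell coordinates of the samples of an arc, with [h] steps in each half.
    Separation allows [X] and [Y] to be read at samples with [l <= k <= l.+1], because the walks
    built later change one coordinate at a time and so visit cells that mix two consecutive
    samples. *)
Lemma planar_walks (G : sgraph) : planar G ->
  exists h N (X Y : G -> G -> nat -> nat),
  [/\ forall x y k, oriented x y -> (k <= h.*2)%N ->
        (0 < X x y k < N)%N /\ (0 < Y x y k < N)%N,
      forall x y k, oriented x y -> (k < h.*2)%N ->
        [/\ (X x y k.+1 <= (X x y k).+1)%N, (X x y k <= (X x y k.+1).+1)%N,
            (Y x y k.+1 <= (Y x y k).+1)%N & (Y x y k <= (Y x y k.+1).+1)%N],
      forall x y, oriented x y ->
        [/\ X x y 0%N = X x x 0%N, Y x y 0%N = Y x x 0%N,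
            X x y h.*2 = X y y 0%N & Y x y h.*2 = Y y y 0%N] &
      forall (p p' : G * G * bool) k l k' l',
        oriented p.1.1 p.1.2 -> oriented p'.1.1 p'.1.2 -> owner p != owner p' -> p.1 != p'.1 ->
        in_half h p.2 k -> in_half h p.2 l -> (l <= k <= l.+1)%N ->
        in_half h p'.2 k' -> in_half h p'.2 l' -> (l' <= k' <= l'.+1)%N ->
        ~ (X p.1.1 p.1.2 k = X p'.1.1 p'.1.2 k' /\ Y p.1.1 p.1.2 l = Y p'.1.1 p'.1.2 l')].
Proof.
case=> px [py [cx [cy [p_inj [arcs crossings]]]]].
pose f x y := fx px cx x y; pose g x y := fy py cy x y.
have fgc x y : oriented x y -> continuity (f x y) /\ continuity (g x y) by apply: f_cont.
pose sep (p p' : G * G * bool) n := 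
  oriented p.1.1 p.1.2 -> oriented p'.1.1 p'.1.2 -> owner p != owner p' -> p.1 != p'.1 ->
  forall s t, half_time p.2 s -> half_time p'.2 t ->
  ~ (Rabs (f p.1.1 p.1.2 s - f p'.1.1 p'.1.2 t) < / INR n.+1 /\
     Rabs (g p.1.1 p.1.2 s - g p'.1.1 p'.1.2 t) < / INR n.+1).
have invle n n' : (n <= n')%N -> / INR n'.+1 <= / INR n.+1.
  move=> le; apply: Rinv_le_contravar; first by apply: lt_0_INR; lia.
  by apply: le_INR; apply/leP.
have [n1 sep1] : exists n, forall q : (G * G * bool) * (G * G * bool), sep q.1 q.2 n.
  apply: finite_uniform => [q n n' le h o o' ne ne1 s t hs ht [l1 l2]|[p p']].
    by apply: (h o o' ne ne1 s t hs ht); have := invle _ _ le; split; lra.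
  have [o|no] := boolP (oriented p.1.1 p.1.2); last by exists 0%N => H; rewrite H in no.
  have [o'|no] := boolP (oriented p'.1.1 p'.1.2); last by exists 0%N => ? H; rewrite H in no.
  have [ne|no] := boolP (owner p != owner p'); last by exists 0%N => ? ? H; rewrite H in no.
  have [ne1|no] := boolP (p.1 != p'.1); last by exists 0%N => ? ? ? H; rewrite H in no.
  have [cf cg] := fgc _ _ o; have [cf' cg'] := fgc _ _ o'.
  have hd s t (hs : half_time p.2 s) (ht : half_time p'.2 t) :=
    halves_disjoint p_inj arcs crossings o o' ne ne1 hs ht.
  rewrite -/(f p.1.1 p.1.2) in hd.
  have [n nP] : exists n : nat, forall s t, half_time p.2 s -> half_time p'.2 t ->
    ~ (Rabs (f p.1.1 p.1.2 s - f p'.1.1 p'.1.2 t) < / INR n.+1 /\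
       Rabs (g p.1.1 p.1.2 s - g p'.1.1 p'.1.2 t) < / INR n.+1).
    by move: hd; case: p.2; case: p'.2 => hd; apply: arcs_apart => //; lra.
  by exists n => _ _ _ _; exact: nP.
(* One third for each of three errors in the second coordinate: either curve moves by less than [de]
   between its two samples, and equal cell numbers put the sampled values within [de]. *)
pose de := / INR n1.+1 / 3.
have de0 : 0 < de.
  have : 0 < / INR n1.+1 by apply/Rinv_0_lt_compat/lt_0_INR; lia.
  rewrite /de; lra.
have [n2 uni] : exists n, forall q : G * G, oriented q.1 q.2 ->
    forall s t, 0 <= s <= 1 -> 0 <= t <= 1 -> Rabs (s - t) <= / INR n.+1 ->
    Rabs (f q.1 q.2 s - f q.1 q.2 t) < de /\ Rabs (g q.1 q.2 s - g q.1 q.2 t) < de.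
  apply: finite_uniform => [q n n' le h o s t s01 t01 st|[x y]].
    by apply: h => //; have := invle _ _ le; lra.
  have [o|no] := boolP (oriented x y); last by exists 0%N => H; case/negP: no.
  have [cf cg] := fgc _ _ o.
  have [n nP] := uniform_arc cf de0; have [k kP] := uniform_arc cg de0.
  exists (maxn n k) => _ s t s01 t01 st; split; [apply: nP | apply: kP] => //.
    by have := invle _ _ (leq_maxl n k); lra.
  by have := invle _ _ (leq_maxr n k); lra.
pose h := n2.+1; pose L := INR h.*2.
have L0 : 0 < L by apply: lt_0_INR; rewrite /h; lia.
have Lle : / L <= / INR n2.+1.
  apply: Rinv_le_contravar; first by apply: lt_0_INR; lia.
  by apply: le_INR; rewrite /h; lia.
pose tau k := INR k / L.
have tau01 k : (k <= h.*2)%N -> 0 <= tau k <= 1.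
  move=> le; have le' : INR k <= L by apply: le_INR; apply/leP.
  have := pos_INR k; rewrite /tau => p; split.
    by apply: Rmult_le_pos => //; apply/Rlt_le/Rinv_0_lt_compat.
  by apply: (Rmult_le_reg_r L) => //; rewrite Rmult_1_l /Rdiv Rmult_assoc Rinv_l ?Rmult_1_r
      //; lra.
have tau_close k l : (l <= k <= l.+1)%N -> Rabs (tau k - tau l) <= / INR n2.+1.
  move=> kl; apply: Rle_trans Lle; rewrite /tau /Rdiv -Rmult_minus_distr_r Rabs_mult.
  rewrite (Rabs_pos_eq (/ L)); last by apply/Rlt_le/Rinv_0_lt_compat.
  rewrite -[X in _ <= X]Rmult_1_l; apply: Rmult_le_compat_r.
    by apply/Rlt_le/Rinv_0_lt_compat.
  have [->|->] : k = l \/ k = l.+1 by lia.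
    by rewrite Rminus_diag Rabs_R0; lra.
  by rewrite S_INR; apply: Rabs_le; lra.
have tau_half s k : in_half h s k -> half_time s (tau k).
  have tau_h : tau h = 1 / 2.
    have h0 : 0 < INR h by apply: lt_0_INR; rewrite /h; lia.
    by rewrite /tau /L -addnn plus_INR; field; lra.
  have tau_le a b : (a <= b)%N -> tau a <= tau b.
    move=> ab; apply: Rmult_le_compat_r; first by apply/Rlt_le/Rinv_0_lt_compat.
    by apply: le_INR; apply/leP.
  rewrite /in_half /half_time -tau_h; case: s => [/andP[h1 h2]|h1].
    by split; [apply: tau_le | have := tau01 _ h2; lra].
  split; last exact: tau_le.
  have kh : (k <= h.*2)%N by lia.
  by have := tau01 k kh; lra.
pose samp (q : G * G * 'I_h.*2.+1) := tau (nat_of_ord q.2).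
have [n3 bnd] : exists n, forall q : G * G * 'I_h.*2.+1,
    Rabs (f q.1.1 q.1.2 (samp q)) <= INR n /\ Rabs (g q.1.1 q.1.2 (samp q)) <= INR n.
  apply: finite_uniform => [q n n' le [l1 l2]|q].
    have le' : INR n <= INR n' by apply: le_INR; apply/leP.
    by split; lra.
  have bd r : exists n, Rabs r <= INR n.
    by have [n l] := INR_archimed 1 (Rabs r) Rlt_0_1; exists n; lra.
  have [n nP] := bd (f q.1.1 q.1.2 (samp q)); have [k kP] := bd (g q.1.1 q.1.2 (samp q)).
  exists (maxn n k).
  have h1 : INR n <= INR (maxn n k) by apply: le_INR; apply/leP/leq_maxl.
  have h2 : INR k <= INR (maxn n k) by apply: le_INR; apply/leP/leq_maxr.
  by split; [apply: Rle_trans nP h1 | apply: Rle_trans kP h2].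
(* The shift by [Q] makes all cell numbers positive, which keeps the cells off the axes of the
   torus. *)
pose Q := INR n3 / de + 1.
pose cellno r := Z.to_nat (up (r / de + Q)).
pose N := (Z.to_nat (up (2 * Q))).+1.
have cell_pos r : Rabs r <= INR n3 -> (0 < up (r / de + Q))%Z /\ (0 < cellno r < N)%N.
  move=> rn; have rde : Rabs (r / de) <= INR n3 / de.
    rewrite /Rdiv Rabs_mult (Rabs_pos_eq (/ de)); last by apply/Rlt_le/Rinv_0_lt_compat.
    by apply: Rmult_le_compat_r => //; apply/Rlt_le/Rinv_0_lt_compat.
  have [a1 a2] : - (INR n3 / de) <= r / de <= INR n3 / de by move: rde; split_Rabs; lra.
  have [u1 u2] := archimed (r / de + Q); have [v1 v2] := archimed (2 * Q).
  have up0 : (0 < up (r / de + Q))%Z by apply: lt_IZR; rewrite /Q in u1 *; lra.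
  have ule : (up (r / de + Q) <= up (2 * Q))%Z.
    suff : (up (r / de + Q) < up (2 * Q) + 1)%Z by lia.
    by apply: lt_IZR; rewrite plus_IZR; rewrite /Q in u1 u2 v1 v2 *; lra.
  by split=> //; rewrite /cellno /N; lia.
have scale r r' : Rabs (r - r') < de <-> Rabs (r / de + Q - (r' / de + Q)) < 1.
  have -> : r / de + Q - (r' / de + Q) = (r - r') / de by field; lra.
  rewrite /Rdiv Rabs_mult (Rabs_pos_eq (/ de)); last by apply/Rlt_le/Rinv_0_lt_compat.
  split=> lt.
    have -> : 1 = de * / de by field; lra.
    by apply: Rmult_lt_compat_r => //; apply: Rinv_0_lt_compat.
  have -> : Rabs (r - r') = Rabs (r - r') * / de * de by field; lra.
  rewrite -[X in _ < X]Rmult_1_l; exact: Rmult_lt_compat_r.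
have cell_step r r' : Rabs r <= INR n3 -> Rabs r' <= INR n3 -> Rabs (r - r') < de ->
    (cellno r <= (cellno r').+1)%N.
  move=> /cell_pos[p1 _] /cell_pos[p2 _] /scale/up_close; rewrite /cellno; lia.
have cell_eq r r' : Rabs r <= INR n3 -> Rabs r' <= INR n3 -> cellno r = cellno r' ->
    Rabs (r - r') < de.
  move=> /cell_pos[p1 _] /cell_pos[p2 _] E; apply/scale/up_eq_close.
  by move: E; rewrite /cellno; lia.
have bf x y k : (k <= h.*2)%N -> Rabs (f x y (tau k)) <= INR n3.
  by rewrite -ltnS => lt; have [] := bnd (x, y, Ordinal lt).
have bg x y k : (k <= h.*2)%N -> Rabs (g x y (tau k)) <= INR n3.
  by rewrite -ltnS => lt; have [] := bnd (x, y, Ordinal lt).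
exists h, N, (fun x y k => cellno (f x y (tau k))), (fun x y k => cellno (g x y (tau k))).
have tau0 : tau 0%N = 0 by rewrite /tau /Rdiv Rmult_0_l.
have tau1 : tau h.*2 = 1 by rewrite /tau -/L; field; lra.
split.
- move=> x y k o kh; split; first by have [] := cell_pos _ (bf x y k kh).
  by have [] := cell_pos _ (bg x y k kh).
- move=> x y k o kh; have kh' := ltnW kh.
  have [|c1 c2] := uni (x, y) o (tau k.+1) (tau k) (tau01 _ kh) (tau01 _ kh').
    by apply: tau_close; lia.
  rewrite /= Rabs_minus_sym in c1; have c1' := c1; rewrite Rabs_minus_sym in c1'.
  rewrite /= Rabs_minus_sym in c2; have c2' := c2; rewrite Rabs_minus_sym in c2'.
  by split; apply: cell_step => //; (apply: bf || apply: bg).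
- move=> x y o; have [e1 e2 e3 e4] := f_ends arcs o.
  have fxx z t : f z z t = px z by rewrite /f /fx eqxx.
  have gxx z t : g z z t = py z by rewrite /g /fy eqxx.
  by rewrite tau0 tau1 !fxx !gxx /f /g e1 e2 e3 e4.
move=> p p' k l k' l' o o' ne ne1 kp lp kl kp' lp' kl' [EX EY].
have le s j : in_half h s j -> (j <= h.*2)%N.
  by rewrite /in_half; case: s => [/andP[]|] //; lia.
have c1 := cell_eq _ _ (bf _ _ _ (le _ _ kp)) (bf _ _ _ (le _ _ kp')) EX.
have c2 := cell_eq _ _ (bg _ _ _ (le _ _ lp)) (bg _ _ _ (le _ _ lp')) EY.
have [_ c3] := uni p.1 o (tau k) (tau l) (tau01 _ (le _ _ kp)) (tau01 _ (le _ _ lp))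
    (tau_close _ _ kl).
have [_ c4] := uni p'.1 o' (tau k') (tau l') (tau01 _ (le _ _ kp')) (tau01 _ (le _ _ lp'))
    (tau_close _ _ kl').
apply: (sep1 (p, p') o o' ne ne1 (tau k) (tau k') (tau_half _ _ kp) (tau_half _ _ kp')).
have dd : / INR n1.+1 = 3 * de by rewrite /de; field; apply: not_0_INR.
rewrite /= dd; split; first by lra.
by move: c2 c3 c4; split_Rabs; lra.
Qed.

Local Close Scope R_scope.

(** * Connectivity in finite graphs *)

Section Connectivity.
Variables (V : finType) (e : rel V).

Definition ein (A : {set V}) : rel V :=
  fun x y => [&& x \in A, y \in A & e x y].
Definition conn (A : {set V}) :=
  forall x y, x \in A -> y \in A -> connect (ein A) x y.
Definition touch (A B : {set V}) := exists x y, [/\ x \in A, y \in B & e x y].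

Hypothesis e_sym : symmetric e.

Lemma ein_sym A : symmetric (ein A).
Proof. by move=> x y; rewrite /ein e_sym andbCA. Qed.

Lemma ein_csym A : connect_sym (ein A).
Proof. by apply: sym_connect_sym; apply: ein_sym. Qed.

Lemma connect_einS (A B : {set V}) x y :
  A \subset B -> connect (ein A) x y -> connect (ein B) x y.
Proof.
move=> /subsetP sAB; apply: connect_sub => u v /and3P[uA vA euv].
by apply: connect1; rewrite /ein !sAB.
Qed.

Lemma ein1 (A : {set V}) x y :
  x \in A -> y \in A -> e x y -> connect (ein A) x y.
Proof. by move=> xA yA exy; apply: connect1; rewrite /ein xA yA. Qed.

Lemma connect_ein_mem (A : {set V}) x y :
  x \in A -> connect (ein A) x y -> y \in A.
Proof.
move=> xA /connectP[p]; elim: p x xA => [|z p IH] x xA /=; first by move=> _ ->.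
by case/andP=> /and3P[_ zA _]; apply: IH.
Qed.

Lemma connect_exit (r : rel V) (C : {set V}) x y :
  connect r x y -> x \in C -> y \notin C ->
  exists u v, [/\ u \in C, v \notin C, r u v & connect r x u].
Proof.
case/connectP=> p; elim/last_ind: p y => [|p z IH] y.
  by move=> _ -> ->.
rewrite rcons_path last_rcons => /andP[pp rz] -> xC zC.
have [lC|lC] := boolP (last x p \in C).
  by exists (last x p), z; split=> //; apply/connectP; exists p.
exact: IH pp erefl xC lC.
Qed.

Lemma conn_hub (A0 A : {set V}) :
  A0 \subset A -> conn A0 ->
  (forall x, x \in A -> exists2 y, y \in A0 & connect (ein A) x y) -> conn A.
Proof.
move=> sA0 cA0 hub x y xA yA.
have [x' x'A cx] := hub x xA; have [y' y'A cy] := hub y yA.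
apply: connect_trans cx _; rewrite ein_csym in cy.
by apply: connect_trans cy; apply: connect_einS sA0 _; apply: cA0.
Qed.

(* Every vertex of [W] is attached to a seed by joining the part of one of its
   neighbours, which keeps each part connected to its seeds. *)
Lemma absorb (I : eqType) (W S0 : {set V}) (c0 : V -> I) :
  (forall x, x \in W -> exists2 y, y \in S0 & connect (ein W) x y) ->
  S0 \subset W ->
  exists c : V -> I, (forall x, x \in S0 -> c x = c0 x) /\
   (forall x, x \in W -> exists2 y, y \in S0 &
       connect (ein [set z in W | c z == c x]) x y).
Proof.
have [k] := ubnP #|W :\: S0|; elim: k S0 c0 => // k IH S0 c0 ltk hub sS0.
have [/eqP W0|[x]] := set_0Vmem (W :\: S0).
  exists c0; split=> // x xW; exists x => //; move: W0.
  by rewrite setD_eq0 => /subsetP/(_ x xW).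
rewrite inE => /andP[xS0 xW].
have [y yS0 cxy] := hub x xW.
have [||u [v [uS vS euv _]]] := @connect_exit (ein W) (~: S0) x y cxy.
- by rewrite inE.
- by rewrite inE yS0.
rewrite !inE negbK in uS vS; case/and3P: euv => uW vW euv.
pose c1 z := if z == u then c0 v else c0 z.
have [|||c [cE ch]] := IH (u |: S0) c1.
- rewrite -ltnS; apply: leq_trans ltk; rewrite ltnS.
  apply: proper_card; rewrite properE; apply/andP; split.
    by apply/subsetP=> z; rewrite !inE negb_or => /andP[/andP[_ ->] ->].
  by apply/subsetPn; exists u; rewrite !inE ?eqxx ?uS ?uW.
- move=> z zW; have [z' zS cz] := hub z zW; exists z' => //.
  by rewrite inE zS orbT.
- by rewrite subUset sub1set uW.
have cS z : z \in S0 -> c z = c0 z.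
  move=> zS; rewrite cE ?inE ?zS ?orbT // /c1.
  by case: eqP => // zu; move: uS; rewrite -zu zS.
exists c; split=> // z zW; have [z' + cz] := ch z zW.
rewrite !inE => /orP[/eqP z'u|z'S]; last by exists z'.
rewrite {z'}z'u in cz; exists v => //; apply: connect_trans (cz) _.
have: u \in [set w in W | c w == c z].
  by apply: connect_ein_mem cz; rewrite inE zW eqxx.
rewrite inE => /andP[_ /eqP cu].
have cuv: c u = c v by rewrite (cS v) // cE ?inE ?eqxx // /c1 eqxx.
by apply: ein1 => //; rewrite inE ?uW ?vW -?cuv cu eqxx.
Qed.

Lemma bfs_tree (r : V) : (forall x, connect e r x) ->
  exists (dep : V -> nat) (up : V -> V),
   [/\ dep r = 0,
       forall v, v != r -> e v (up v) /\ dep v = (dep (up v)).+1 &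
       forall u v, e u v -> dep u <= (dep v).+1].
Proof.
move=> conn_r.
pose P n v := [exists p : n.-tuple V, path e r p && (last r p == v)].
have exP v : exists n, P n v.
  have /connectP[p pp ->] := conn_r v; exists (size p).
  by apply/existsP; exists (in_tuple p); rewrite pp /=.
pose dep v := ex_minn (exP v).
have depP v : P (dep v) v by rewrite /dep; case: ex_minnP.
have depM v n : P n v -> dep v <= n by rewrite /dep; case: ex_minnP => k _; apply.
have lip u v : e u v -> dep u <= (dep v).+1.
  move=> euv; apply: depM; have /existsP[p /andP[pp /eqP lp]] := depP v.
  apply/existsP; exists [tuple of rcons p u]; rewrite rcons_path pp last_rcons lp.
  by rewrite e_sym euv eqxx.
have dr : dep r = 0.
  apply/eqP; rewrite -leqn0; apply: depM; apply/existsP; exists [tuple].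
  by rewrite /= eqxx.
have exup v : v != r -> exists u, e v u && (dep v == (dep u).+1).
  move=> vr; have /existsP[[p sp] /andP[/= pp /eqP lp]] := depP v.
  case/lastP: p sp pp lp => [|p z] sp; first by move=> _ /= vE; rewrite vE eqxx in vr.
  rewrite rcons_path last_rcons => /andP[pp ez] zv; rewrite {z}zv in sp ez.
  exists (last r p); rewrite e_sym ez /=; rewrite eqn_leq lip ?[e v _]e_sym //=.
  move: sp; rewrite size_rcons => /eqP <-; rewrite ltnS; apply: depM.
  by apply/existsP; exists (in_tuple p); rewrite /= pp eqxx.
exists dep, (fun v => odflt v [pick u | e v u && (dep v == (dep u).+1)]).
split=> // v vr; case: pickP => [u /andP[-> /eqP ->] //|no].
by have [u] := exup v vr; rewrite no.
Qed.

End Connectivity.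

(** * The triangulated torus *)

From mathcomp Require Import all_algebra.
Import GRing.Theory.

Section Torus.
Variable m : nat.
Local Open Scope ring_scope.

Local Notation torus := ('I_m.+2 * 'I_m.+2)%type.
(* The torus replaces a triangulated sphere: in all colourings below both axes are
   in one class, and contracting them turns the torus into a sphere. Unlike a
   disc, it has no boundary edges. *)
Definition tedge := (option bool * torus)%type.
(** Every unit square is cut by its diagonal into two triangles, told apart by the direction of the
    first step from the base point to the opposite corner. *)
Definition ttri := (bool * torus)%type.
Definition tdir (d : option bool) : torus :=
  if d is Some b then (if b then (1, 0) else (0, 1)) else (1, 1).
Definition esrc (a : tedge) : torus := a.2.
Definition etgt (a : tedge) : torus := a.2 + tdir a.1.
Definition side1 (t : ttri) : tedge := (Some t.1, t.2).
Definition side2 (t : ttri) : tedge := (Some (~~ t.1), t.2 + tdir (Some t.1)).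
Definition side3 (t : ttri) : tedge := (None, t.2).
Definition corners (t : ttri) : seq torus :=
  [:: t.2; t.2 + tdir (Some t.1); t.2 + tdir None].
Definition tadj : rel torus := fun x y =>
  [exists a : tedge, ((esrc a == x) && (etgt a == y)) || ((esrc a == y) && (etgt a == x))].
Definition axes : {set torus} := [set x | (x.1 == 0) || (x.2 == 0)].

Lemma tdirN b : tdir (Some b) + tdir (Some (~~ b)) = tdir None.
Proof. by case: b; rewrite /tdir /= ; congr pair; rewrite /= ?addr0 ?add0r. Qed.

Lemma tadj_sym : symmetric tadj.
Proof. by move=> x y; apply: eq_existsb => a; rewrite orbC. Qed.

Lemma tadjE (a : tedge) : tadj (esrc a) (etgt a).
Proof. by apply/existsP; exists a; rewrite !eqxx. Qed.

Lemma corners_adj t x y :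
  x \in corners t -> y \in corners t -> x = y \/ tadj x y.
Proof.
have h1 := tadjE (side1 t); have h2 := tadjE (side2 t); have h3 := tadjE (side3 t).
rewrite /etgt /= -addrA tdirN in h2.
rewrite !inE => /or3P[]/eqP-> /or3P[]/eqP->; try by [left | right | right; rewrite tadj_sym].
Qed.

(** Every edge is a side of exactly two triangles, the surface being closed. The second side of a
    triangle does not start at its base point, so that sum is reindexed by a translation of the
    torus. *)
Lemma double_count (R : nmodType) (F : tedge -> ttri -> R) :
  \sum_t (F (side1 t) t + F (side2 t) t + F (side3 t) t) =
  \sum_a (F a (if a.1 is Some b then (b, a.2) else (true, a.2)) +
          F a (if a.1 is Some b then (~~ b, a.2 - tdir (Some (~~ b))) else (false, a.2))).
Proof.
rewrite [RHS](eq_bigr (fun p => (fun d v =>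
   F (d, v) (if d is Some b then (b, v) else (true, v)) +
   F (d, v) (if d is Some b then (~~ b, v - tdir (Some (~~ b))) else (false, v))) p.1 p.2));
  last by case.
rewrite -(pair_bigA _ (fun d v =>
   F (d, v) (if d is Some b then (b, v) else (true, v)) +
   F (d, v) (if d is Some b then (~~ b, v - tdir (Some (~~ b))) else (false, v)))) /=.
rewrite [LHS](eq_bigr (fun p => (fun b v =>
   F (Some b, v) (b, v) + F (Some (~~ b), v + tdir (Some b)) (b, v) + F (None, v) (b,
       v)) p.1 p.2));
  last by case.
rewrite -(pair_bigA _ (fun b v =>
   F (Some b, v) (b, v) + F (Some (~~ b), v + tdir (Some b)) (b, v) + F (None, v) (b, v))) /=.
have big_opt (G : option bool -> R) : \sum_d G d = G None + G (Some true) + G (Some false).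
  rewrite (bigD1 None) //= (bigD1 (Some true)) //= (bigD1 (Some false)) //= big1 ?addr0 ?addrA //.
  by case=> [[]|].
have big_bl (G : bool -> R) : \sum_d G d = G true + G false by rewrite big_bool.
rewrite big_opt big_bl /= !big_split /=.
have re b : \sum_(v : torus) F (Some (~~ b), v + tdir (Some b)) (b, v) =
            \sum_(v : torus) F (Some (~~ b), v) (b, v - tdir (Some b)).
  have inj : injective (fun v : torus => v + tdir (Some b)) by exact: addIr.
  rewrite [RHS](reindex_inj inj) /=.
  by apply: eq_bigr => v _; rewrite addrK.
rewrite (re true) (re false) /=.
by rewrite (AC (3*3) ((3*6)*(1*5)*(4*2))).
Qed.

Lemma F2xx (x : 'F_2) : x + x = 0.
Proof. by apply/eqP; case: x => [[|[|n]]]. Qed.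

Lemma F2_addr0P (x y : 'F_2) : x + y = 0 <-> x = y.
Proof.
split=> [xy|->]; last exact: F2xx.
by rewrite -[x]addr0 -(F2xx y) addrA xy add0r.
Qed.

Lemma shx (i j : 'I_m.+2) : (i, j) + (1, 0) = (i + 1, j) :> torus.
Proof. by congr pair; rewrite /= addr0. Qed.

Lemma shy (i j : 'I_m.+2) : (i, j) + (0, 1) = (i, j + 1) :> torus.
Proof. by congr pair; rewrite /= addr0. Qed.

(* The integral of [f] up a column is the sought potential: it is well defined on
   the torus because [f] vanishes on both axes, which generate its homology. *)
Lemma torus_coboundary (f : tedge -> 'F_2) :
  (forall t, f (side1 t) + f (side2 t) + f (side3 t) = 0) ->
  (forall a, esrc a \in axes -> etgt a \in axes -> f a = 0) ->
  exists g : torus -> 'F_2, forall a, f a = g (esrc a) + g (etgt a).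
Proof.
move=> cocyc f_ax.
have fT v : f (None, v) = f (Some true, v) + f (Some false, v + (1, 0)).
  by apply/esym/F2_addr0P; apply: (cocyc (true, v)).
have fF v : f (None, v) = f (Some false, v) + f (Some true, v + (0, 1)).
  by apply/esym/F2_addr0P; apply: (cocyc (false, v)).
have f0S v : f (Some true, v + (0, 1)) =
    f (Some true, v) + f (Some false, v) + f (Some false, v + (1, 0)).
  rewrite (AC 3 ((1*3)*2)) /= -fT fF addrC addrA F2xx add0r //.
have fax0 i : f (Some true, (i, 0)) = 0.
  by apply: f_ax; rewrite inE /esrc /etgt /= ?addr0 ?eqxx ?orbT.
have fax1 j : f (Some false, (0, j)) = 0.
  by apply: f_ax; rewrite inE /esrc /etgt /= ?addr0 ?eqxx ?orbT.
pose G i n := \sum_(k < n) f (Some false, (i, k%:R)).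
(* The cocycle condition summed over the strip of triangles between columns [i] and [i + 1], from
   the axis up to height [n]. *)
have f0E i n : f (Some true, (i, n%:R)) = G i n + G (i + 1) n.
  elim: n => [|n IH]; first by rewrite /G !big_ord0 addr0 fax0.
  rewrite -natr1 -shy.
  rewrite f0S IH shx /G !big_ord_recr /=.
  by rewrite -addrA addrACA.
have N0 : (m.+2)%:R = 0 :> 'I_m.+2 by exact: (@pchar_Zp m.+2 isT).
(* The total around a column is zero: neighbouring columns have equal totals, since they differ by a
   horizontal edge on the axis, and column 0 is itself an axis. *)
have GN i : G i m.+2 = 0.
  have GS j : G (j + 1) m.+2 = G j m.+2.
    by apply/esym/F2_addr0P; rewrite -f0E N0.
  rewrite -[i]natr_Zp; elim: (nat_of_ord i) => [|k IH].
    by rewrite /G big1.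
  by rewrite -natr1 GS.
pose g (v : torus) := G v.1 v.2.
have g0 v : f (Some true, v) = g v + g (v + (1, 0)).
  by case: v => i j; rewrite shx -{1}[j]natr_Zp f0E.
have g1 v : f (Some false, v) = g v + g (v + (0, 1)).
  case: v => i j; rewrite shy /g.
  have [lt_j|ge_j] := ltnP j.+1 m.+2.
    have -> : (j + 1)%R = j.+1 :> nat by rewrite /= modn_small // addn1.
    by rewrite {2}/G big_ord_recr /= natr_Zp addrA F2xx add0r.
  have jE : (j : nat) = m.+1 by apply/eqP; rewrite eqn_leq -ltnS ltn_ord.
  have -> : (j + 1)%R = 0%N :> nat by rewrite /= jE addn1 modnn.
  have jR : j = m.+1%:R by rewrite -[LHS]natr_Zp; congr (_%:R).
  have := GN i; rewrite {1}/G big_ord_recr /= -/(G i m.+1).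
  by rewrite jE [G i 0]big_ord0 addr0 jR => /F2_addr0P ->.
exists g => -[[[]|] v]; rewrite /esrc /etgt /=; [exact: g0 | exact: g1 |].
rewrite fT g0 g1 -addrA [X in g v + X]addrA F2xx add0r.
have -> : v + (1, 0) + (0, 1) = v + (1, 1) :> torus.
  by rewrite -addrA; congr (_ + _); congr pair; rewrite /= ?addr0 ?add0r.
by [].
Qed.
End Torus.

Local Open Scope ring_scope.

Lemma sum_bool_card (T : finType) (P : pred T) : (\sum_t P t)%N = #|[set t | P t]|.
Proof.
rewrite -sum1_card [RHS]big_mkcond /=; apply: eq_bigr => t _.
by rewrite inE; case: (P t).
Qed.

Lemma F2_nat_even n : (n%:R == 0 :> 'F_2) = ~~ odd n.
Proof. by rewrite -(dvdn_pcharf (pchar_Fp (isT : prime 2))) dvdn2. Qed.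

Lemma F2_nat (b : bool) n : (odd n = b) -> n%:R = b%:R :> 'F_2.
Proof.
by move=> <-; rewrite -{1}(odd_double_half n) -mul2n natrD natrM [2%:R]pchar_Fp_0 // mul0r addr0.
Qed.

(** * Parity and exact counts of rainbow triangles in a coloured torus *)

Section Rainbow.
Variable m : nat.
Local Notation torus := ('I_m.+2 * 'I_m.+2)%type.
Variable c : torus -> nat.
Local Notation col t := (map c (corners t)).

Definition ijedge i j (a : tedge m) : bool :=
  ((c (esrc a) == i) && (c (etgt a) == j)) || ((c (esrc a) == j) && (c (etgt a) == i)).
Definition ijtri i j (t : ttri m) : bool :=
  [&& uniq (col t), i \in col t & j \in col t].

Lemma side_ends (t : ttri m) :
  ((esrc (side1 t) = t.2) * (etgt (side1 t) = (t.2 + tdir m (Some t.1))%R) *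
   (esrc (side2 t) = (t.2 + tdir m (Some t.1))%R) * (etgt (side2 t) = (t.2 + tdir m None)%R) *
   (esrc (side3 t) = t.2) * (etgt (side3 t) = (t.2 + tdir m None)%R))%type.
Proof. by rewrite /etgt /= -addrA tdirN. Qed.

(** Sperner's parity: a triangle without three distinct colours has zero or two sides with end
    colours [i] and [j], and a trichromatic one containing both colours has exactly one. *)
Lemma ijtriE i j t : i != j ->
  (ijedge i j (side1 t))%:R + (ijedge i j (side2 t))%:R + (ijedge i j (side3 t))%:R
  = (ijtri i j t)%:R :> 'F_2.
Proof.
move=> ij; rewrite -!natrD; apply: F2_nat.
rewrite /ijedge /ijtri /corners /=.
rewrite !side_ends.
move: (c _) (c _) (c _) => x y z; rewrite !inE ![i == _]eq_sym ![j == _]eq_sym.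
have [->|xi] := eqVneq x i; have [->|yi] := eqVneq y i; have [->|zi] := eqVneq z i;
 rewrite ?eqxx ?(negPf ij) ?[j == i]eq_sym ?(negPf ij) ?(negPf xi) ?(negPf yi) ?(negPf zi) /=
     ?andbT ?andbF ?orbF //=.
all: lia.
Qed.

Lemma ijtri_even i j : i != j -> ~~ odd #|[set t | ijtri i j t]|.
Proof.
move=> ij; rewrite -F2_nat_even -sum_bool_card natr_sum.
under eq_bigr do rewrite -ijtriE //.
rewrite (double_count (fun a _ => (ijedge i j a)%:R : 'F_2)).
by rewrite big1 // => a _; rewrite F2xx.
Qed.

Definition rainbow012 (t : ttri m) := all (fun i => i \in col t) (iota 0 3).

Lemma rainbow012_even : (forall x, c x < 3)%N -> ~~ odd #|[set t | rainbow012 t]|.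
Proof.
move=> c3; have := @ijtri_even 0 1 isT; congr (~~ odd _); apply: eq_card => t.
rewrite !inE /ijtri /rainbow012 /corners /=.
have := c3 t.2; have := c3 (t.2 + tdir m (Some t.1)); have := c3 (t.2 + tdir m None).
by move: (c _) (c _) (c _) => x y z; rewrite !inE; lia.
Qed.

Hypothesis c_ax : forall x y, x \in axes m -> y \in axes m -> c x = c y.
Hypothesis c_conn : forall i, conn (@tadj m) [set x | c x == i].

(** The potential found on the torus does not change along monochromatic edges, so it is constant on
    each connected class and descends to colours. This is the vanishing of the first cohomology
    after the classes have been contracted. *)
Lemma class_coboundary (f : tedge m -> 'F_2) :
  (forall t, f (side1 t) + f (side2 t) + f (side3 t) = 0) ->
  (forall a, c (esrc a) = c (etgt a) -> f a = 0) ->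
  exists G : nat -> 'F_2, forall a, f a = G (c (esrc a)) + G (c (etgt a)).
Proof.
move=> cocyc fmono.
have [|g gE] := torus_coboundary cocyc.
  by move=> a sa ta; apply: fmono; apply: c_ax.
have g_adj x y : c x = c y -> tadj x y -> g x = g y.
  move=> cxy /existsP[a /orP[]/andP[/eqP sa /eqP ta]]; apply/F2_addr0P.
    by rewrite -sa -ta -gE fmono // sa ta.
  by rewrite addrC -sa -ta -gE fmono // sa ta.
have g_const x y : c x = c y -> g x = g y.
  move=> cxy; have := @c_conn (c x) x y.
  rewrite !inE cxy eqxx => /(_ isT isT) /connectP[p]; elim: p x {cxy} => [|z p IH] x /=.
    by move=> _ ->.
  case/andP=> /and3P[]; rewrite !inE => /eqP cx /eqP cz xz /IH{}IH /IH <-.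
  by apply: g_adj => //; rewrite cx.
exists (fun i => if [pick x | c x == i] is Some x then g x else 0) => a.
rewrite gE; congr (_ + _); case: pickP => [x /eqP /g_const //|].
- by move/(_ (esrc a)); rewrite eqxx.
- by move/(_ (etgt a)); rewrite eqxx.
Qed.

Hypothesis c4 : forall x, (c x < 4)%N.
Hypothesis c_touch : forall i j, (i < 4)%N -> (j < 4)%N -> i != j ->
  touch (@tadj m) [set x | c x == i] [set x | c x == j].

Lemma c_edge i j : (i < 4)%N -> (j < 4)%N -> i != j -> exists a, ijedge i j a.
Proof.
move=> i4 j4 ij; have [x [y [+ + /existsP[a xy]]]] := c_touch i4 j4 ij.
rewrite !inE => /eqP xi /eqP yj; exists a.
by case/orP: xy => /andP[/eqP sa /eqP ta]; rewrite /ijedge sa ta xi yj !eqxx ?orbT.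
Qed.

(** Without such a triangle the indicator of the edges between classes [i] and [j] would be a
    cocycle, hence [G i + G j = 1] for a potential [G] on colours. A third colour [k] touches both
    classes by edges of value 0, which gives [G i = G k = G j]. Parity raises the bound from 1 to
    2. *)
Lemma ijtri_ge2 i j : (i < 4)%N -> (j < 4)%N -> i != j ->
  (2 <= #|[set t | ijtri i j t]|)%N.
Proof.
move=> i4 j4 ij; have ev := ijtri_even ij.
suff: #|[set t | ijtri i j t]| != 0%N by move: ev; case: #|_| => [|[|]].
apply/negP; rewrite cards_eq0 => /eqP t0.
have [||G GE] := @class_coboundary (fun a => (ijedge i j a)%:R).
- move=> t; rewrite ijtriE //; have : t \notin [set t | ijtri i j t] by rewrite t0 inE.
  by rewrite inE => /negPf ->.
- move=> a; rewrite /ijedge => ->; case: eqP => [->|_]; last by rewrite andbF.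
  by rewrite (negPf ij).
have [k [k4 ki kj]] : exists k, [/\ (k < 4)%N, k != i & k != j].
  exists (if (i != 0%N) && (j != 0%N) then 0%N
          else if (i != 1%N) && (j != 1%N) then 1%N else 2%N).
  by case: ifP; [|case: ifP]; split; lia.
have GEij x y a : ijedge x y a -> G x + G y = (ijedge i j a)%:R.
  by rewrite GE => /orP[]/andP[/eqP-> /eqP->] //; rewrite addrC.
have [a ija] := c_edge i4 j4 ij; have := GEij _ _ _ ija; rewrite ija.
have [b ikb] := c_edge k4 i4 ki; have := GEij _ _ _ ikb.
have [d jkd] := c_edge k4 j4 kj; have := GEij _ _ _ jkd.
have -> : ijedge i j b = false by move: ikb ki kj ij; rewrite /ijedge; lia.
have -> : ijedge i j d = false by move: jkd ki kj ij; rewrite /ijedge; lia.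
by move=> /F2_addr0P <- /F2_addr0P <-; rewrite F2xx.
Qed.

Definition bond : {set tedge m} := [set a | c (esrc a) != c (etgt a)].
Definition mixed : {set ttri m} :=
  [set t | [|| side1 t \in bond, side2 t \in bond | side3 t \in bond]].
Definition incid (a : tedge m) (t : ttri m) : 'F_2 :=
  (side1 t == a)%:R + (side2 t == a)%:R + (side3 t == a)%:R.

Lemma sum_incid_edge (f : tedge m -> 'F_2) t :
  \sum_a f a * incid a t = f (side1 t) + f (side2 t) + f (side3 t).
Proof.
have h b : \sum_a f a * (b == a)%:R = f b.
  rewrite (bigD1 b) //= eqxx mulr1 big1 ?addr0 // => a ab.
  by rewrite eq_sym (negPf ab) mulr0.
by rewrite /incid; under eq_bigr do rewrite !mulrDr; rewrite !big_split /= !h.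
Qed.

Definition tri1 (a : tedge m) : ttri m := if a.1 is Some b then (b, a.2) else (true, a.2).
Definition tri2 (a : tedge m) : ttri m :=
  if a.1 is Some b then (~~ b, a.2 - tdir m (Some (~~ b))) else (false, a.2).

Lemma sum_incid_tri (l : ttri m -> 'F_2) a :
  \sum_t incid a t * l t = l (tri1 a) + l (tri2 a).
Proof.
rewrite /incid; under eq_bigr do rewrite !mulrDl.
rewrite (double_count (fun b t => (b == a)%:R * l t)) (bigD1 a) //= eqxx !mul1r.
by rewrite big1 ?addr0 // => b /negPf ->; rewrite !mul0r addr0.
Qed.

Lemma tri12_side t : [/\ t = tri1 (side1 t) \/ t = tri2 (side1 t),
  t = tri1 (side2 t) \/ t = tri2 (side2 t) & t = tri1 (side3 t) \/ t = tri2 (side3 t)].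
Proof.
case: t => b v; rewrite /tri1 /tri2 /=; split; first by left.
  by right; rewrite negbK addrK.
by case: b; [left | right].
Qed.

(* Count of bond edges with multiplicity: a bichromatic triangle has two, a
   trichromatic one three. *)
Lemma bond_count : (2 * #|bond| = 2 * #|mixed| + #|[set t | uniq (col t)]|)%N.
Proof.
pose b a : nat := a \in bond.
have h : (\sum_t (b (side1 t) + b (side2 t) + b (side3 t)) = \sum_a (b a + b a))%N.
  apply/eqP; rewrite -(Num.Theory.eqr_nat int) !natr_sum; apply/eqP.
  under eq_bigr do rewrite !natrD.
  rewrite (double_count (fun a _ => (b a)%:R : int)).
  by apply: eq_bigr => a _; rewrite natrD.
have -> : #|bond| = (\sum_a b a)%N by rewrite sum_bool_card; apply: eq_card => a; rewrite inE.
have -> : #|mixed| = (\sum_t (t \in mixed))%N.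
  by rewrite sum_bool_card; apply: eq_card => a; rewrite inE.
rewrite mul2n -addnn -big_split /= -h -sum_bool_card.
rewrite big_distrr -big_split /=; apply: eq_bigr => t _.
rewrite /b !inE !side_ends /= ?inE.
by move: (c _) (c _) (c _) => x y z; lia.
Qed.

(** The kernel of [A] consists of the cocycles supported on bond edges, and that of [A^T] of the
    labellings of mixed triangles that agree across every bond edge. Their dimensions turn the two
    ways of computing the rank into Euler's formula. *)
Let A : 'M['F_2]_(#|bond|, #|mixed|) :=
  \matrix_(i, j) incid (enum_val i) (enum_val j).

Lemma sum_bond (F : tedge m -> 'F_2) : (forall a, a \notin bond -> F a = 0) ->
  \sum_(i < #|bond|) F (enum_val i) = \sum_a F a.
Proof.
move=> F0; rewrite -big_enum_val big_mkcond /=; apply: eq_bigr => a _.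
by case: ifPn => // /F0.
Qed.

Lemma sum_mixed (F : ttri m -> 'F_2) : (forall t, t \notin mixed -> F t = 0) ->
  \sum_(i < #|mixed|) F (enum_val i) = \sum_t F t.
Proof.
move=> F0; rewrite -big_enum_val big_mkcond /=; apply: eq_bigr => a _.
by case: ifPn => // /F0.
Qed.

Lemma incid_mixed a t : a \in bond -> t \notin mixed -> incid a t = 0.
Proof.
move=> ab; rewrite inE !negb_or => /and3P[h1 h2 h3].
have n b : b \notin bond -> (b == a) = false by apply: contraNF => /eqP ->.
by rewrite /incid !n // !addr0.
Qed.

Definition cut i (a : tedge m) : 'F_2 := (c (esrc a) == i)%:R + (c (etgt a) == i)%:R.

Lemma cut_mono i a : a \notin bond -> cut i a = 0.
Proof. by rewrite inE negbK /cut => /eqP ->; rewrite F2xx. Qed.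

Lemma cut_cocycle i t : cut i (side1 t) + cut i (side2 t) + cut i (side3 t) = 0.
Proof.
rewrite /cut !side_ends.
move: (c t.2 == i)%:R (c (_ + tdir m (Some _)) == i)%:R (c (_ + tdir m None) == i)%:R => x y z.
by rewrite (AC (2*2*2) ((1*5)*(2*3)*(4*6))) /= !F2xx.
Qed.

(** The cuts of classes 0, 1 and 2 form a basis. They are independent because an edge between
    classes [i] and 3 is seen by [cut i] alone among them. They span because a potential [G] on
    colours can be normalised to vanish at 3, and its coordinates are then [G i + G 3]. *)
Lemma rank_ker_bond : \rank (kermx A) = 3%N.
Proof.
pose B : 'M['F_2]_(3, #|bond|) := \matrix_(i, j) cut i (enum_val j).
transitivity (\rank B); last first.
  apply/eqP; change (row_free B).
  apply: inj_row_free => v vB; apply/rowP => i; rewrite mxE.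
  have i4 : (i < 4)%N by apply: ltn_trans (ltn_ord i) _.
  have i3 : (i : nat) != 3 by rewrite neq_ltn ltn_ord.
  have [a ia] := c_edge i4 (isT : (3 < 4)%N) i3.
  have ab : a \in bond by move: ia i3; rewrite inE /ijedge; lia.
  have cutE (k : 'I_3) : cut k a = (k == i)%:R.
    have k3 := ltn_ord k; rewrite /cut -(inj_eq val_inj) /=.
    by case/orP: ia => /andP[/eqP -> /eqP ->]; rewrite ![_ == nat_of_ord k]eq_sym
      (ltn_eqF k3) ?addr0 ?add0r.
  have := congr1 (fun M : 'rV_#|bond| => M 0 (enum_rank_in ab a)) vB.
  rewrite !mxE (bigD1 i) //= mxE enum_rankK_in // cutE eqxx mulr1 big1 ?addr0 //.
  by move=> k /negPf ki; rewrite mxE enum_rankK_in // cutE ki mulr0.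
apply: eqmx_rank; apply/andP; split; last first.
  apply/sub_kermxP/matrixP => i j; rewrite !mxE.
  transitivity (\sum_a cut i a * incid a (enum_val j)); last first.
    by rewrite sum_incid_edge cut_cocycle.
  rewrite -sum_bond => [|a /cut_mono ->]; last by rewrite mul0r.
  by apply: eq_bigr => k _; rewrite !mxE.
apply/rV_subP => u /sub_kermxP uA.
pose f a := \sum_i (enum_val i == a)%:R * u 0 i.
have fE i : f (enum_val i) = u 0 i.
  rewrite /f (bigD1 i) //= eqxx mul1r big1 ?addr0 // => k ki.
  by rewrite (inj_eq enum_val_inj) (negPf ki) mul0r.
have f0 a : a \notin bond -> f a = 0.
  move=> ab; rewrite /f big1 // => i _; case: eqP => [ia|_]; last by rewrite mul0r.
  by rewrite -ia enum_valP in ab.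
have cocyc t : f (side1 t) + f (side2 t) + f (side3 t) = 0.
  have [tm|] := boolP (t \in mixed); last first.
    by rewrite inE !negb_or => /and3P[h1 h2 h3]; rewrite !f0 // !addr0.
  rewrite -sum_incid_edge -sum_bond => [|a /f0 ->]; last by rewrite mul0r.
  have := congr1 (fun M : 'rV_#|mixed| => M 0 (enum_rank_in tm t)) uA.
  by rewrite !mxE => {2}<-; apply: eq_bigr => k _; rewrite fE mxE enum_rankK_in.
have [|G GE] := class_coboundary cocyc.
  by move=> a ca; apply: f0; rewrite inE ca eqxx.
apply/submxP; exists (\row_i (G i + G 3)); apply/rowP => j; rewrite -fE GE mxE.
set a := enum_val j.
transitivity (\sum_(i < 3) (G i + G 3) * cut i a); last first.
  by apply: eq_bigr => k _; rewrite !mxE.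
have h x : (x < 4)%N -> \sum_(i < 3) (G i + G 3) * (x == i)%:R = G x + G 3.
  rewrite !big_ord_recl big_ord0 /=.
  by case: x => [|[|[|[|]]]] //= _; rewrite ?mulr0 ?mulr1 ?addr0 ?add0r ?F2xx.
rewrite /cut; under eq_bigr do rewrite mulrDr.
by rewrite big_split /= !h // addrACA F2xx addr0.
Qed.

(** For a labelling [l] in the kernel, the product [F i] of [l] with [cut i] is again a cocycle, as
    all bond sides of a triangle carry the label of that triangle. Its potential is constant on the
    classes other than [i], which touch pairwise, so [l] is constant around class [i]; edges between
    two classes then link the constants. *)
Lemma rank_ker_mixed : \rank (kermx A^T) = 1%N.
Proof.
have [a0 a0E] := c_edge (isT : (0 < 4)%N) (isT : (1 < 4)%N) isT.
have a0b : a0 \in bond by move: a0E; rewrite inE /ijedge; lia.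
have tri1_mixed a : a \in bond -> tri1 a \in mixed.
  by case: a => [[b|] v] ab; rewrite inE /side1 /side3 /= ab ?orbT.
have tri2_mixed a : a \in bond -> tri2 a \in mixed.
  case: a => [[b|] v] ab; rewrite inE /side1 /side2 /side3 /= ?negbK ?subrK ab ?orbT //.
have t0m := tri1_mixed _ a0b.
transitivity (\rank (const_mx 1 : 'rV['F_2]_#|mixed|)); last first.
  rewrite rank_rV; case: eqP => // /(congr1 (fun M : 'rV_#|mixed| => M 0 (enum_rank_in t0m
      (tri1 a0)))).
  by rewrite !mxE => /eqP; rewrite oner_eq0.
apply: eqmx_rank; apply/andP; split; last first.
  apply/sub_kermxP/matrixP => i j; rewrite !mxE.
  transitivity (\sum_t incid (enum_val j) t * 1).
    rewrite -sum_mixed => [|t /(incid_mixed (enum_valP j)) ->]; last by rewrite mul0r.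
    by apply: eq_bigr => k _; rewrite !mxE mulrC.
  by rewrite (sum_incid_tri (fun=> 1)) F2xx.
apply/rV_subP => u /sub_kermxP uA.
pose l t := \sum_i (enum_val i == t)%:R * u 0 i.
have lE i : l (enum_val i) = u 0 i.
  rewrite /l (bigD1 i) //= eqxx mul1r big1 ?addr0 // => k ki.
  by rewrite (inj_eq enum_val_inj) (negPf ki) mul0r.
have l12 a : a \in bond -> l (tri1 a) = l (tri2 a).
  move=> ab; apply/F2_addr0P; rewrite -sum_incid_tri.
  rewrite -sum_mixed => [|t /(incid_mixed ab) ->]; last by rewrite mul0r.
  have := congr1 (fun M : 'rV_#|bond| => M 0 (enum_rank_in ab a)) uA.
  by rewrite !mxE => {2}<-; apply: eq_bigr => k _; rewrite lE !mxE enum_rankK_in // mulrC.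
have l_side t : [/\ side1 t \in bond -> l (tri1 (side1 t)) = l t,
  side2 t \in bond -> l (tri1 (side2 t)) = l t & side3 t \in bond -> l (tri1 (side3 t)) = l t].
  have [h1 h2 h3] := tri12_side t.
  by split=> sb; [case: h1 | case: h2 | case: h3] => {2}->; rewrite // l12.
pose F i a := l (tri1 a) * cut i a.
have F0 i a : a \notin bond -> F i a = 0 by move=> /cut_mono h; rewrite /F h mulr0.
have FG i : exists G : nat -> 'F_2, forall a, F i a = G (c (esrc a)) + G (c (etgt a)).
  apply: class_coboundary => [t|a ca]; last by apply: F0; rewrite inE ca eqxx.
  have [h1 h2 h3] := l_side t.
  have hF a : (a \in bond -> l (tri1 a) = l t) -> F i a = l t * cut i a.
    by move=> h; have [/h E|/[dup] /F0 -> /cut_mono ->] := boolP (a \in bond);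
        rewrite ?mulr0 // /F E.
  by rewrite !hF // -!mulrDr cut_cocycle mulr0.
(* Two bond edges at colour class [i] receive the same value of [l]: this is the
   connectivity of the dual boundary cycle of the class. *)
have l_class i a b : (i < 4)%N -> a \in bond -> b \in bond ->
    (c (esrc a) == i) || (c (etgt a) == i) ->
    (c (esrc b) == i) || (c (etgt b) == i) -> l (tri1 a) = l (tri1 b).
  move=> i4 ab bb ai bi; have [G GE] := FG i.
  have Gjk j k : (j < 4)%N -> (k < 4)%N -> j != i -> k != i -> G j = G k.
    move=> j4 k4 ji ki; have [-> //|jk] := eqVneq j k.
    have [d jkd] := c_edge j4 k4 jk; apply/F2_addr0P.
    have : F i d = 0.
      by rewrite /F /cut; case/orP: jkd => /andP[/eqP-> /eqP->];
         rewrite (negPf ji) (negPf ki) addr0 mulr0.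
    by rewrite GE; case/orP: jkd => /andP[/eqP-> /eqP->] //; rewrite addrC.
  have val d : d \in bond -> (c (esrc d) == i) || (c (etgt d) == i) ->
     exists j, [/\ (j < 4)%N, j != i & l (tri1 d) = G i + G j].
    rewrite inE => dn di; have := GE d; rewrite /F /cut.
    have [si|si] := eqVneq (c (esrc d)) i.
      exists (c (etgt d)); split; rewrite // -?si 1?eq_sym //.
      by move: H; rewrite -?si [_ == c (esrc d)]eq_sym (negPf dn) addr0 mulr1.
    have ti : c (etgt d) == i by move: di; rewrite (negPf si).
    exists (c (esrc d)); split=> //; move: H.
    by rewrite (eqP ti) eqxx add0r mulr1 addrC.
  have [j [j4 ji ->]] := val a ab ai; have [k [k4 ki ->]] := val b bb bi.
  by rewrite (Gjk j k).
have l_const a b : a \in bond -> b \in bond -> l (tri1 a) = l (tri1 b).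
  move=> ab bb; have [e|ne] := eqVneq (c (esrc a)) (c (esrc b)).
    by apply: (l_class (c (esrc a))) => //; rewrite ?e eqxx.
  have [d dE] := c_edge (c4 (esrc a)) (c4 (esrc b)) ne.
  have db : d \in bond by move: dE ne; rewrite inE /ijedge; lia.
  transitivity (l (tri1 d)); [apply: (l_class (c (esrc a))) | apply: (l_class (c (esrc b)))]
      => //;
    
    rewrite ?eqxx //; by case/orP: dE => /andP[h1 h2]; rewrite ?h1 ?h2 ?orbT.
apply/submxP; exists (const_mx (l (tri1 a0))); apply/rowP => j.
rewrite !mxE big_ord1 !mxE mulr1 -lE.
have [h1 h2 h3] := l_side (enum_val j).
have : enum_val j \in mixed by apply: enum_valP.
by rewrite inE => /or3P[] s; [rewrite -h1 | rewrite -h2 | rewrite -h3] => //; apply: l_const.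
Qed.

(** Both kernels belong to one rank: [#|bond| - 3 = #|mixed| - 1]. Substituting this in the side
    count [bond_count] leaves four trichromatic triangles. *)
Lemma rainbow_count : #|[set t | uniq (col t)]| = 4%N.
Proof.
have := bond_count; have := rank_ker_bond; have := rank_ker_mixed.
rewrite !mxrank_ker mxrank_tr; have := rank_leq_row A; have := rank_leq_col A; lia.
Qed.

(* Euler's formula by ranks over F_2: cocycles of the bond edges have dimension 3,
   relations among the mixed triangles dimension 1, so there are four rainbow
   triangles. Each pair of colours occurs in at least two of them. *)
Lemma rainbow012_unique : #|[set t | rainbow012 t]| = 1%N.
Proof.
pose n (k : nat) := #|[set t | uniq (col t) && (k \notin col t)]|.
have n4 : (n 0 + n 1 + n 2 + n 3 = 4)%N.
  rewrite -rainbow_count /n -!sum_bool_card -!big_split /=; apply: eq_bigr => t _.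
  rewrite /corners /= !inE.
  have := c4 t.2; have := c4 (t.2 + tdir m (Some t.1)); have := c4 (t.2 + tdir m None).
  by move: (c _) (c _) (c _) => [|[|[|[|x]]]] [|[|[|[|y]]]] [|[|[|[|z]]]].
have nij (i j k l : nat) : (i < 4)%N -> (j < 4)%N -> i != j -> perm_eq [:: i; j; k;
    l] (iota 0 4) ->
   (2 <= n k + n l)%N.
  move=> i4 j4 ij pe; apply: leq_trans (ijtri_ge2 i4 j4 ij) _.
  have u : uniq [:: i; j; k; l] by rewrite (perm_uniq pe).
  have le t : (ijtri i j t <= (uniq (col t) && (k \notin col t)) + (uniq (col t) && (l \notin
      col t)))%N.
    case: (boolP (ijtri i j t)) => // /and3P[-> it jt].
    have [kt|] := boolP (k \in col t); have [lt|] := boolP (l \in col t) => //.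
    have : {subset [:: i; j; k; l] <= col t}.
      by apply/allP; rewrite /all it jt kt lt.
    by move/(uniq_leq_size u).
  rewrite /n -!sum_bool_card -!big_split; apply: leq_sum => t _; exact: le.
have <- : n 3%N = #|[set t | rainbow012 t]|.
  apply: eq_card => t; rewrite !inE /rainbow012 /corners /= !inE.
  have := c4 t.2; have := c4 (t.2 + tdir m (Some t.1)); have := c4 (t.2 + tdir m None).
  by move: (c _) (c _) (c _) => [|[|[|[|x]]]] [|[|[|[|y]]]] [|[|[|[|z]]]].
(* Complementary pairs of the numbers [n k] each sum to at least 2 and together to 4, so every pair
   sums to 2 and every [n k] is 1. *)
have := nij 0%N 1%N 2%N 3%N isT isT isT isT; have := nij 0%N 2%N 1%N 3%N isT isT isT isT.
have := nij 0%N 3%N 1%N 2%N isT isT isT isT; have := nij 1%N 2%N 0%N 3%N isT isT isT isT.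
have := nij 1%N 3%N 0%N 2%N isT isT isT isT; have := nij 2%N 3%N 0%N 1%N isT isT isT isT.
lia.
Qed.

End Rainbow.

Local Close Scope ring_scope.

(** * Vertical tripods *)

Definition rainbow (V : finType) (c : V -> nat) (s : seq V) :=
  all (fun i => i \in map c s) (iota 0 3).

(* What remains of planarity: [tri] lists the triangles of a triangulated sphere,
   seen through a contraction onto [V] with connected fibres. *)
Definition spherical (V : finType) (e : rel V) (T : finType) (tri : T -> seq V) :=
  [/\ forall t x y, x \in tri t -> y \in tri t -> x = y \/ e x y,
      forall c : V -> nat, (forall x, c x < 3) ->
        ~~ odd #|[set t | rainbow c (tri t)]| &
      forall c : V -> nat, (forall x, c x < 4) ->
        (forall i, conn e [set x | c x == i]) ->
        (forall i j, i < 4 -> j < 4 -> i != j ->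
           touch e [set x | c x == i] [set x | c x == j]) ->
        #|[set t | rainbow c (tri t)]| = 1].

Lemma touchP (V : finType) (e : rel V) (A B : {set V}) :
  reflect (touch e A B) [exists x in A, exists y in B, e x y].
Proof.
apply: (iffP exists_inP) => [[x xA /exists_inP[y yB xy]]|[x [y [xA yB xy]]]].
  by exists x, y.
by exists x => //; apply/exists_inP; exists y.
Qed.

Lemma touchS (V : finType) (e : rel V) (A B A' B' : {set V}) :
  A \subset A' -> B \subset B' -> touch e A B -> touch e A' B'.
Proof.
move=> /subsetP sA /subsetP sB [x [y [xA yB xy]]].
by exists x, y; rewrite sA ?sB.
Qed.

Lemma touch_sym (V : finType) (e : rel V) (A B : {set V}) :
  symmetric e -> touch e A B -> touch e B A.
Proof. by move=> es [x [y [xA yB xy]]]; exists y, x; rewrite es. Qed.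

Section Tripods.
Variables (V : finType) (e : rel V) (r : V) (dep : V -> nat) (up : V -> V).
Variables (T : finType) (tri : T -> seq V).
Hypothesis e_sym : symmetric e.
Hypothesis V_conn : forall x, connect e r x.
Hypothesis dep_r : dep r = 0.
Hypothesis up_e : forall v, v != r -> e v (up v).
Hypothesis dep_up : forall v, v != r -> dep v = (dep (up v)).+1.
Hypothesis sph : spherical e tri.

Definition part (S : {set V}) (pi : V -> nat) i := [set x in S | pi x == i].
Definition component (S : {set V}) x := [set y | connect (ein e (~: S)) x y].

Lemma component_refl (S : {set V}) x : x \in component S x.
Proof. by rewrite inE connect0. Qed.

Lemma comp_out (S : {set V}) x y : x \notin S -> y \in component S x -> y \notin S.
Proof.
move=> xS; rewrite inE => /connect_ein_mem; rewrite !inE; exact.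
Qed.

Lemma comp_closed (S : {set V}) x u v : x \notin S ->
  u \in component S x -> v \notin S -> e u v -> v \in component S x.
Proof.
move=> xS uC vS uv; have uS := comp_out xS uC; move: uC; rewrite !inE => xu.
by apply: connect_trans xu _; apply: ein1 => //; rewrite inE.
Qed.

Lemma conn_comp (S : {set V}) x : x \notin S -> conn e (component S x).
Proof.
move=> xS.
have h y : y \in component S x -> connect (ein e (component S x)) x y.
  rewrite inE => /connectP[p]; elim/last_ind: p y => [|p z IH] y.
    by move=> _ ->; apply: connect0.
  rewrite rcons_path last_rcons => /andP[pp ez] ->.
  have lC : last x p \in component S x by rewrite inE; apply/connectP; exists p.
  apply: connect_trans (IH _ pp erefl) _.
  case/and3P: ez => _ zS ez; apply: ein1 => //.
  by apply: comp_closed ez => //; move: zS; rewrite inE.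
move=> y z /h yx /h zx; apply: connect_trans zx.
by rewrite ein_csym.
Qed.

Lemma compS (S S' : {set V}) x : S \subset S' -> component S' x \subset component S x.
Proof.
move=> sS; apply/subsetP=> y; rewrite !inE.
by apply: connect_einS; rewrite setCS.
Qed.

(** The invariant of the construction after [n] parts covering [S]. By [st_clique] the parents of a
    part are themselves related as parents, so the quotient lies in a 3-tree whose elimination order
    is the order of creation. In [st_comp], [K] may list more parts than the component touches. *)
Record state n (S : {set V}) (pi : V -> nat) (par : nat -> seq nat) : Prop := State {
  st_r : r \in S;
  st_pi : forall x, x \in S -> pi x < n;
  st_conn : forall i, conn e (part S pi i);
  st_width : forall i k, #|[set x in S | (pi x == i) && (dep x == k)]| <= 3;
  st_edge : forall x y, x \in S -> y \in S -> e x y -> pi x < pi y -> pi x \in par (pi y);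
  st_par : forall i, size (par i) <= 3;
  st_par_lt : forall i j, i < n -> j \in par i -> j < i;
  st_clique : forall i p q, i < n -> p \in par i -> q \in par i -> p < q -> p \in par q;
  st_comp : forall x, x \notin S -> exists K : seq nat,
    [/\ uniq K, size K <= 3,
        forall i, touch e (component S x) (part S pi i) -> i \in K &
        forall i j, i \in K -> j \in K -> i != j -> touch e (part S pi i) (part S pi j)] }.

Lemma state0 : state 1 [set r] (fun=> 0) (fun=> [::]).
Proof.
split=> //.
- by rewrite inE.
- by move=> i x y; rewrite !inE => /andP[/eqP-> _] /andP[/eqP-> _]; apply: connect0.
- move=> i k; apply: leq_trans (_ : #|[set r]| <= _); last by rewrite cards1.
  by apply: subset_leq_card; apply/subsetP=> x; rewrite !inE => /andP[].
- move=> x xr; exists [:: 0]; split=> //.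
    by move=> i [y [z [_ + _]]]; rewrite !inE => /andP[_]; rewrite eq_sym.
  by move=> i j; rewrite !inE => /eqP-> /eqP->.
Qed.

Section Step.
Variables (n : nat) (S : {set V}) (pi : V -> nat) (par : nat -> seq nat).
Hypothesis st : state n S pi par.

Lemma notin_r x : x \notin S -> x != r.
Proof. by apply: contraNneq => ->; apply: (st_r st). Qed.

Lemma up_ind (P : V -> Prop) :
  (forall x, x \in S -> P x) -> (forall x, x \notin S -> P (up x) -> P x) ->
  forall x, P x.
Proof.
move=> PS Pup x; have [k] := ubnP (dep x); elim: k x => // k IH x ltk.
have [|xS] := boolP (x \in S); first exact: PS.
by apply: Pup => //; apply: IH; move: ltk; rewrite (dep_up (notin_r xS)).
Qed.

(** The depth serves as fuel: after [dep x] steps the vertical path is at [r], which lies in [S], so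
    the path has met [S] before the fuel is spent. The foot is the part it enters; [vpath] collects
    the vertices before that. *)
Fixpoint foot_rec k x := if x \in S then pi x else if k is k'.+1 then foot_rec k' (up x) else 0.
Definition foot x := foot_rec (dep x) x.
Fixpoint vpath_rec k x :=
  if k is k'.+1 then if x \in S then set0 else x |: vpath_rec k' (up x) else set0.
Definition vpath x := vpath_rec (dep x) x.

Lemma footS x : x \in S -> foot x = pi x.
Proof. by rewrite /foot; case: (dep x) => [|k] /= ->. Qed.

Lemma foot_up x : x \notin S -> foot x = foot (up x).
Proof. by move=> xS; rewrite /foot (dep_up (notin_r xS)) /= (negPf xS). Qed.

Lemma vpathS x : x \in S -> vpath x = set0.
Proof. by rewrite /vpath; case: (dep x) => [|k] //= ->. Qed.

Lemma vpath_up x : x \notin S -> vpath x = x |: vpath (up x).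
Proof. by move=> xS; rewrite /vpath (dep_up (notin_r xS)) /= (negPf xS). Qed.

Lemma vpath_out x y : y \in vpath x -> y \notin S /\ dep y <= dep x.
Proof.
elim/up_ind: x => [x xS|x xS IH]; first by rewrite vpathS ?inE.
rewrite vpath_up // !inE => /orP[/eqP->|/IH[yS le]]; first by [].
by split=> //; apply: leq_trans le _; rewrite (dep_up (notin_r xS)).
Qed.

Lemma vpath_dep x y z : y \in vpath x -> z \in vpath x -> dep y = dep z -> y = z.
Proof.
have lt u w : u \notin S -> w \in vpath (up u) -> dep w < dep u.
  by move=> uS /vpath_out[_ le]; rewrite (dep_up (notin_r uS)).
elim/up_ind: x => [x xS|x xS IH]; first by rewrite vpathS ?inE.
rewrite vpath_up // !inE => /orP[/eqP->|yv] /orP[/eqP->|zv] // d; last exact: IH.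
  by have := lt _ _ xS zv; rewrite -d ltnn.
by have := lt _ _ xS yv; rewrite d ltnn.
Qed.

Lemma vpath_refl x : x \notin S -> x \in vpath x.
Proof. by move=> xS; rewrite vpath_up // !inE eqxx. Qed.

Lemma vpath_next x y : y \in vpath x -> up y \in S \/ up y \in vpath x.
Proof.
elim/up_ind: x => [x xS|x xS IH]; first by rewrite vpathS ?inE.
rewrite vpath_up // !inE => /orP[/eqP->|/IH[]]; [|by left|by move=> ->; right; rewrite orbT].
by have [|uS] := boolP (up x \in S); [left | right; rewrite vpath_refl ?orbT].
Qed.

Lemma vpath_connect x y : y \in vpath x -> connect (ein e (vpath x)) x y.
Proof.
elim/up_ind: x => [x xS|x xS IH]; first by rewrite vpathS ?inE.
have xv := vpath_refl xS.
rewrite {1}vpath_up // !inE => /orP[/eqP->|yv]; first exact: connect0.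
have sub : vpath (up x) \subset vpath x by rewrite (vpath_up xS) subsetUr.
apply: connect_trans (_ : connect _ x (up x)) _; last by apply: connect_einS (IH yv).
have uxS : up x \notin S.
  by apply/negP=> uS; move: yv; rewrite vpathS ?inE.
by apply: ein1 => //; [apply: (subsetP sub); apply: vpath_refl | apply/up_e/notin_r].
Qed.

Lemma vpath_last x : x \notin S -> exists y, [/\ y \in vpath x, up y \in S & pi (up y) = foot x].
Proof.
elim/up_ind: x => [x ->|x xS IH _] //.
have [uS|uS] := boolP (up x \in S).
  by exists x; rewrite vpath_refl // uS foot_up // footS.
have [y [yv yS fy]] := IH uS; exists y; split=> //; last by rewrite foot_up.
by rewrite vpath_up // !inE yv orbT.
Qed.

Variable x0 : V.
Hypothesis x0S : x0 \notin S.
Let C := component S x0.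
Variable K : seq nat.
Hypothesis K_uniq : uniq K.
Hypothesis K_size : size K <= 3.
Hypothesis K_touch : forall i, i \in K <-> touch e C (part S pi i).
Hypothesis K_clique : forall i j, i \in K -> j \in K -> i != j ->
  touch e (part S pi i) (part S pi j).

Lemma C_out x : x \in C -> x \notin S. Proof. exact: comp_out. Qed.

Lemma C_nbr u v : u \in C -> e u v -> v \in C \/ v \in S /\ pi v \in K.
Proof.
move=> uC uv; have [vS|vS] := boolP (v \in S); last by left; apply: comp_closed uv.
by right; split=> //; apply/K_touch; exists u, v; split=> //; rewrite inE vS eqxx.
Qed.

Lemma foot_K x : x \in C -> foot x \in K.
Proof.
elim/up_ind: x => [x xS /C_out|x xS IH xC]; first by rewrite xS.
rewrite foot_up //; have := C_nbr xC (up_e (notin_r xS)).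
by case=> [/IH //|[uS]]; rewrite footS.
Qed.

Lemma vpath_C x : x \in C -> vpath x \subset C.
Proof.
elim/up_ind: x => [x xS /C_out|x xS IH xC]; first by rewrite xS.
rewrite vpath_up // subUset sub1set xC /=.
have := C_nbr xC (up_e (notin_r xS)).
by case=> [/IH //|[uS _]]; rewrite vpathS ?sub0set.
Qed.

Lemma K_lt i : i \in K -> i < n.
Proof.
by move/K_touch=> [x [y [_ + _]]]; rewrite inE => /andP[yS /eqP <-]; exact: (st_pi st yS).
Qed.

Section Extend.
Variable q : nat -> V.
Hypothesis q_foot : forall i, i \in K -> foot (q i) = i /\ (q i \in C \/ q i \in S).
Hypothesis q_adj : forall i j, i \in K -> j \in K -> q i = q j \/ e (q i) (q j).
Hypothesis q_C : exists2 i, i \in K & q i \in C.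
(** One leg for each part seen by [C]. When [q i] already lies in [S] its leg is empty; by [q_adj]
    the starting points of the legs hold the tripod together. *)
Definition tripod := \bigcup_(i <- K) vpath (q i).
Hypothesis q_sep : size K = 3 -> forall x, x \in C -> x \notin tripod ->
  exists2 i, i \in K & ~ touch e (component (S :|: tripod) x) (part S pi i).

Lemma tripodP y : reflect (exists2 i, i \in K & y \in vpath (q i)) (y \in tripod).
Proof.
rewrite /tripod; elim: K => [|i s IH].
  by rewrite big_nil inE; constructor=> -[].
rewrite big_cons inE; apply: (iffP orP) => [[yi|/IH[j js yj]]|[j]].
- by exists i; rewrite ?mem_head.
- by exists j; rewrite // inE js orbT.
- by rewrite inE => /orP[/eqP->|js] yj; [left | right; apply/IH; exists j].
Qed.

Lemma tripod_C : tripod \subset C.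
Proof.
apply/subsetP=> y /tripodP[i iK yv]; have [_ [qC|qS]] := q_foot iK.
  exact: (subsetP (vpath_C qC)).
by rewrite vpathS ?inE in yv.
Qed.

Lemma tripod_out y : y \in tripod -> y \notin S.
Proof. by move/(subsetP tripod_C)/C_out. Qed.

Lemma tripod_q i : i \in K -> q i \in C -> q i \in tripod.
Proof. by move=> iK qC; apply/tripodP; exists i => //; apply/vpath_refl/C_out. Qed.

Lemma conn_tripod : conn e tripod.
Proof.
have toq y : y \in tripod -> exists i, [/\ i \in K,
    q i \in tripod & connect (ein e tripod) (q i) y].
  case/tripodP=> i iK yv; exists i; split=> //.
    apply/tripodP; exists i => //; apply: vpath_refl.
    by apply: contraTN yv => /vpathS ->; rewrite inE.
  apply: connect_einS (vpath_connect yv).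
  by apply/subsetP=> z zv; apply/tripodP; exists i.
move=> y z /toq[i [iK qi iy]] /toq[j [jK qj jz]].
rewrite ein_csym // in iy; apply: connect_trans iy _; apply: connect_trans jz.
by have [->|qq] := q_adj iK jK; [apply: connect0 | apply: ein1].
Qed.

Lemma tripod_touch i : i \in K -> touch e tripod (part S pi i).
Proof.
move=> iK; have [fi qi] := q_foot iK.
case: qi => [qC|qS].
  have [y [yv yS py]] := vpath_last (C_out qC).
  exists y, (up y); split; first by apply/tripodP; exists i.
    by rewrite inE yS py fi eqxx.
  by apply/up_e/notin_r; have [] := vpath_out yv.
have [j jK qj] := q_C; exists (q j), (q i); split.
- exact: tripod_q.
- by rewrite inE qS -(footS qS) fi eqxx.
- have [qq|//] := q_adj jK iK.
  by have := C_out qj; rewrite qq qS.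
Qed.

Let S' := S :|: tripod.
Let pi' x := if x \in tripod then n else pi x.
Let par' i := if i == n then K else par i.

Lemma part_old i : i < n -> part S' pi' i = part S pi i.
Proof.
move=> ltin; apply/setP=> x; rewrite !inE /pi'.
have [xt|xt] := boolP (x \in tripod); last by rewrite orbF.
by rewrite (negPf (tripod_out xt)) (gtn_eqF ltin).
Qed.

Lemma part_new : part S' pi' n = tripod.
Proof.
apply/setP=> x; rewrite !inE /pi'.
have [xt|xt] := boolP (x \in tripod); first by rewrite orbT eqxx.
rewrite orbF; apply/andP=> -[xS /eqP E].
by have := st_pi st xS; rewrite E ltnn.
Qed.

Lemma part_empty i : n < i -> part S' pi' i = set0.
Proof.
move=> lt; apply/setP=> x; rewrite !inE /pi'.
have [xt|xt] := boolP (x \in tripod); first by rewrite orbT (ltn_eqF lt).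
rewrite orbF; apply/andP=> -[xS /eqP E].
by have := st_pi st xS; rewrite E ltnNge ltnW.
Qed.

Lemma part_cases i : [\/ i < n /\ part S' pi' i = part S pi i,
  i = n /\ part S' pi' i = tripod | part S' pi' i = set0].
Proof.
have [lt|gt|->] := ltngtP i n.
- by constructor 1; rewrite part_old.
- by constructor 3; rewrite part_empty.
- by constructor 2; rewrite part_new.
Qed.

Lemma tripod_width k : #|[set x in tripod | dep x == k]| <= 3.
Proof.
pose s := [seq odflt r [pick x in vpath (q i) | dep x == k] | i <- K].
apply: leq_trans (_ : size s <= 3); last by rewrite size_map.
apply: leq_trans (card_size s); apply: subset_leq_card; apply/subsetP=> x.
rewrite inE => /andP[/tripodP[i iK xv] /eqP dx]; apply/mapP; exists i => //.
case: pickP => [y /andP[yv /eqP dy]|/(_ x)]; last by rewrite xv dx eqxx.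
by apply: vpath_dep xv yv _; rewrite dx dy.
Qed.

(** The tripod becomes part [n] with parents [K]. A remaining component inside [C] can touch only
    the new part and those in [K]; when [K] has three elements, [q_sep] frees one of them, so the
    bound of three survives. Components outside [C] do not touch the tripod, which lies in [C]. *)
Lemma state_extend : state n.+1 S' pi' par'.
Proof.
have pi'S x : x \in S -> pi' x = pi x.
  by rewrite /pi'; case: ifP => // /tripod_out/negP.
have pi't x : x \in tripod -> pi' x = n by rewrite /pi' => ->.
have inS' x : x \in S' -> x \in S \/ x \in tripod by rewrite inE => /orP.
split.
- by rewrite inE (st_r st).
- by move=> x /inS'[xS|xt]; [rewrite pi'S // ltnS ltnW // (st_pi st) | rewrite pi't].
- move=> i; have [[_ ->]|[_ ->]|->] := part_cases i.
  + exact: (st_conn st).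
  + exact: conn_tripod.
  + by move=> x; rewrite inE.
- move=> i k.
  have -> : [set x in S' | (pi' x == i) && (dep x == k)] = [set x in part S' pi' i | dep x == k].
    by apply/setP=> x; rewrite !inE andbA.
  have [[_ ->]|[_ ->]|->] := part_cases i.
  + apply: leq_trans (st_width st i k); apply: subset_leq_card.
    by apply/subsetP=> x; rewrite !inE andbA.
  + exact: tripod_width.
  + by rewrite (_ : [set _ in _ | _] = set0) ?cards0 //; apply/setP=> x; rewrite !inE.
- move=> x y /inS' xS' /inS'[yS|yt] xy.
    rewrite (pi'S y) //; case: xS' => [xS|xt]; last first.
      by rewrite pi't // => lt; have := ltn_trans lt (st_pi st yS); rewrite ltnn.
    rewrite pi'S // => lt; rewrite /par' (ltn_eqF (st_pi st yS)).
    exact: (st_edge st).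
  rewrite (pi't y) // /par' eqxx; case: xS' => [xS _|xt]; last by rewrite pi't ?ltnn.
  rewrite pi'S //; apply/K_touch; exists y, x.
  by rewrite (subsetP tripod_C) // e_sym inE xS eqxx.
- by move=> i; rewrite /par'; case: eqP => // _; apply: (st_par st).
- move=> i j; rewrite ltnS leq_eqVlt /par'; case: eqP => [-> _ /K_lt //|_ /=].
  exact: (st_par_lt st).
- move=> i p s; rewrite ltnS leq_eqVlt {1 2}/par'; case: eqP => [_ _ pK sK lt|_ /= lti pi_ si lt].
    have [x [y [+ + xy]]] := K_clique pK sK (negbT (ltn_eqF lt)).
    rewrite !inE => /andP[xS /eqP xp] /andP[yS /eqP ys].
    rewrite /par' (ltn_eqF (K_lt sK)) -xp -ys; apply: (st_edge st) => //.
    by rewrite xp ys.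
  have sn := ltn_trans (st_par_lt st lti si) lti.
  by rewrite /par' (ltn_eqF sn); apply: (st_clique st lti pi_ si lt).
- move=> x xS'; have xS : x \notin S by apply: contra xS'; rewrite inE => ->.
  have xt : x \notin tripod by apply: contra xS'; rewrite inE orbC => ->.
  have sub : component S' x \subset component S x by apply/compS/subsetUl.
  have [xC|xC] := boolP (x \in C).
    have subC : component S' x \subset C.
      apply: subset_trans sub _; apply/subsetP=> y; rewrite !inE.
      by apply: connect_trans; move: xC; rewrite inE.
    have old i : i < n.+1 -> touch e (component S' x) (part S' pi' i) -> i \in n :: K.
      move=> lti; rewrite inE; case: eqP => //= ne; rewrite part_old; last by lia.
      by move=> t; apply/K_touch; apply: touchS t.
    have lt_part i : touch e (component S' x) (part S' pi' i) -> i < n.+1.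
      have [[/ltnW //]|[-> //]|->] := part_cases i.
      by move=> [y [z [_]]]; rewrite inE.
    have nK : n \notin K by apply/negP=> /K_lt; rewrite ltnn.
    have cl i j : i \in n :: K -> j \in n :: K -> i != j ->
        touch e (part S' pi' i) (part S' pi' j).
      rewrite !inE => /orP[/eqP->|iK] /orP[/eqP->|jK]; rewrite ?eqxx // => ij.
      + by rewrite part_new part_old ?K_lt //; apply: tripod_touch.
      + by rewrite part_new part_old ?K_lt //; apply: touch_sym e_sym _; apply: tripod_touch.
      + by rewrite !part_old ?K_lt //; apply: K_clique.
    have [K3|K3] := eqVneq (size K) 3; last first.
      exists (n :: K); split=> //=; [by rewrite nK | by lia |].
      by move=> i ti; apply: (old _ (lt_part _ ti) ti).
    have [i0 i0K nt] := q_sep K3 xC xt.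
    exists (n :: rem i0 K); split=> /=.
    + by rewrite rem_uniq // andbT; apply: contra nK => /mem_rem.
    + by rewrite size_rem // K3.
    + move=> i ti; have := old _ (lt_part _ ti) ti; rewrite !inE.
      case/orP=> [->//|iK]; rewrite (rem_filter _ K_uniq) mem_filter /= iK andbT.
      case: eqP => //= _; apply/negP=> /eqP ii0; apply: nt.
      by rewrite -ii0 -(part_old (K_lt iK)).
    + move=> i j ik jk; apply: cl.
        by move: ik; rewrite !inE => /orP[->//|/mem_rem ->]; rewrite orbT.
      by move: jk; rewrite !inE => /orP[->//|/mem_rem ->]; rewrite orbT.
  have [Kx [uK sK tK cK]] := st_comp st xS.
  (* Indices from [n] on are dropped: their old parts are empty, but index [n] now names the
     tripod. *)
  have [Kx' [uK' sK' tK' cK' ltK']] : exists Kx : seq nat, [/\ uniq Kx, size Kx <= 3,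
        forall i, touch e (component S x) (part S pi i) -> i \in Kx,
        forall i j, i \in Kx -> j \in Kx -> i != j -> touch e (part S pi i) (part S pi j)
        & forall i, i \in Kx -> i < n].
    exists [seq i <- Kx | i < n]; split.
    - exact: filter_uniq.
    - by rewrite size_filter (leq_trans (count_size _ _)).
    - move=> i ti; rewrite mem_filter tK // andbT; case: ti => y [z [_ + _]].
      by rewrite inE => /andP[zS /eqP <-]; exact: (st_pi st zS).
    - by move=> i j; rewrite !mem_filter => /andP[_ iK] /andP[_ jK]; apply: cK.
    - by move=> i; rewrite mem_filter => /andP[].
  exists Kx'; split=> //.
  + move=> i ti; apply: tK'; have := ti.
    have [[_ ->]|[_ ->]|->] := part_cases i.
    * exact: touchS.
    * move=> [y [z [yx zt yz]]]; case/negP: xC; rewrite inE ein_csym //.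
      have zC := subsetP tripod_C _ zt.
      have yC : y \in C.
        apply: (comp_closed x0S zC); last by rewrite e_sym.
        by apply: (comp_out xS); apply: (subsetP sub).
      have := subsetP sub _ yx; rewrite inE => xy; apply: connect_trans xy _.
      by rewrite ein_csym //; move: yC; rewrite inE.
    * by move=> [y [z [_]]]; rewrite inE.
  + by move=> i j iK jK; rewrite !part_old ?ltK' //; apply: cK'.
Qed.

Lemma extend_ex : exists S1 pi1 par1, state n.+1 S1 pi1 par1 /\ S \proper S1.
Proof.
exists S', pi', par'; split; first exact: state_extend.
rewrite properE subsetUl /=; have [i iK qC] := q_C.
by apply/subsetPn; exists (q i); rewrite ?inE ?tripod_q ?orbT // C_out.
Qed.

End Extend.

Lemma K_neq0 : K != [::].
Proof.
have x0r : connect e x0 r by rewrite (sym_connect_sym e_sym).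
have [||u [v [uC vC uv _]]] := connect_exit x0r (C := C).
- exact: component_refl.
- by apply/negP=> /C_out; rewrite (st_r st).
by case: (C_nbr uC uv) => [vC'|[_ vK]]; [rewrite vC' in vC | case: K vK].
Qed.

(** One part needs a single vertical path. For two parts [i] and [j] an edge with feet [i] and [j]
    is sought: either a vertex of [C] next to one part has its foot in the other, or both feet occur
    in the connected set [C] and change along some edge. No separation is required here, as the new
    part and at most two old ones make three. *)
Lemma extend_le2 : size K != 3 ->
  exists S1 pi1 par1, state n.+1 S1 pi1 par1 /\ S \proper S1.
Proof.
move=> K3; have x0C : x0 \in C by apply: component_refl.
case E: K K_neq0 => [//|i [|j [|k s]]] _.
- apply: (@extend_ex (fun=> x0)); rewrite ?E //.
  + by move=> k; rewrite inE => /eqP->; split; [have := foot_K x0C; rewrite E inE => /eqP | left].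
  + by move=> *; left.
  + by exists i; rewrite ?mem_head.
- have ij : i != j by have := K_uniq; rewrite E /= inE andbT.
  have footC x : x \in C -> foot x = i \/ foot x = j.
    by move=> /foot_K; rewrite E !inE => /orP[]/eqP; [left | right].
  have footP x k : x \in part S pi k -> foot x = k /\ x \in S.
    by rewrite inE => /andP[xS /eqP]; rewrite footS.
  have [u [v [uv fu fv [uCS vCS uvC]]]] : exists u v, [/\ e u v, foot u = i, foot v = j &
      [/\ u \in C \/ u \in S, v \in C \/ v \in S & u \in C \/ v \in C]].
    have /K_touch [c [p [cC /footP[fp pS] cp]]] : j \in K by rewrite E !inE eqxx orbT.
    have [fc|fc] := footC c cC; first by exists c, p; split=> //; split; auto.
    have /K_touch [c' [p' [cC' /footP[fp' pS'] cp']]] : i \in K by rewrite E !inE eqxx.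
    have [fc'|fc'] := footC c' cC'; last first.
      by exists p', c'; rewrite e_sym; split=> //; split; auto.
    have [||u [v [ui vi /and3P[uC vC uv] _]]] :=
      connect_exit (conn_comp x0S cC' cC) (C := [set x | foot x == i]).
    + by rewrite inE fc'.
    + by rewrite inE fc eq_sym.
    rewrite !inE in ui vi; exists u, v; split; [exact: uv | exact/eqP | | by split; auto].
    by have [/eqP|//] := footC v vC; rewrite (negPf vi).
  apply: (@extend_ex (fun k => if k == i then u else v)); rewrite ?E //.
  + by move=> k; rewrite in_cons mem_seq1; have [->|_ /= /eqP->] := eqVneq k i; split.
  + move=> k l _ _; case: eqP => _; case: eqP => _; first by left.
    * by right.
    * by right; rewrite e_sym.
    * by left.
  + case: uvC => [uC|vC]; first by exists i; rewrite ?mem_head ?eqxx.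
    by exists j; [rewrite in_cons mem_head orbT | rewrite eq_sym (negPf ij)].
- by move: K_size K3; rewrite E /= !ltnS leqn0 => /eqP->.
Qed.

(** * Components touching three parts: the tripod found by parity *)

Section Trichromatic.
Hypothesis K3 : size K = 3.

Let seeds := [set x in S | pi x \in K].

(** A walk towards [x0] enters [C] from a vertex of [S] whose part is in [K]. Hence [absorb] can
    spread the three parts over the entire complement of [C]. *)
Lemma seeds_hub x : x \in ~: C -> exists2 y, y \in seeds & connect (ein e (~: C)) x y.
Proof.
move=> xC.
have xx0 : connect e x x0.
  by apply: connect_trans (V_conn x0); rewrite (sym_connect_sym e_sym).
have [||u [v [uZ vZ uv _]]] := connect_exit xx0 (C := [set z | connect (ein e (~: C)) x z]).
- by rewrite inE connect0.
- rewrite inE; apply/negP=> /(connect_ein_mem xC).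
  by rewrite inE component_refl.
rewrite !inE in uZ vZ; have uC := connect_ein_mem xC uZ.
have vC : v \in C.
  apply: contraR vZ => vC; apply: connect_trans uZ _.
  by apply: ein1 => //; rewrite inE.
rewrite e_sym in uv; case: (C_nbr vC uv) => [uC'|[uS uK]].
  by rewrite inE uC' in uC.
by exists u; rewrite // inE uS.
Qed.

Lemma index_lt3 i : i \in K -> index i K < 3.
Proof. by rewrite -index_mem K3. Qed.

Lemma index_K i j : i \in K -> j \in K -> index i K = index j K -> i = j.
Proof. exact: (index_inj 0). Qed.

Lemma trichromatic : exists q : nat -> V,
  [/\ forall i, i \in K -> foot (q i) = i /\ (q i \in C \/ q i \in S),
      forall i j, i \in K -> j \in K -> q i = q j \/ e (q i) (q j),
      exists2 i, i \in K & q i \in C &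
      forall x, x \in C -> x \notin tripod q ->
        exists2 i, i \in K & ~ touch e (component (S :|: tripod q) x) (part S pi i)].
Proof.
have [tri_adj tri_even tri_uniq] := sph.
have seedsC : seeds \subset ~: C.
  apply/subsetP=> y; rewrite in_setC {1}/seeds in_set => /andP[yS _].
  by apply/negP=> /C_out; rewrite yS.
have [c [cE ch]] := absorb (fun y => index (pi y) K) seeds_hub seedsC.
have c_hub x : x \notin C -> exists2 y, y \in seeds &
    c y = c x /\ connect (ein e [set z in ~: C | c z == c x]) x y.
  move=> xC; have xC' : x \in ~: C by rewrite inE.
  have [y yS xy] := ch x xC'; exists y => //; split=> //.
  have : y \in [set z in ~: C | c z == c x] by apply: connect_ein_mem xy; rewrite inE xC' eqxx.
  by rewrite inE => /andP[_ /eqP].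
(* Feet decide inside [C] and absorbed parts outside, so three classes cover everything. The fourth
   colour is reserved for the set [D], to which the uniqueness count is applied. *)
pose c3 x := if x \in C then index (foot x) K else c x.
pose c4 (D : {set V}) x := if x \in D then 3 else c3 x.
have c3_lt x : c3 x < 3.
  rewrite /c3; case: ifPn => [/foot_K/index_lt3//|/c_hub[y yS [<- _]]].
  by rewrite cE //; apply: index_lt3; move: yS; rewrite inE => /andP[].
have c3_part i x : i \in K -> x \in part S pi i -> x \notin C /\ c3 x = index i K.
  move=> iK; rewrite inE => /andP[xS /eqP xi].
  have xC : x \notin C by apply/negP=> /C_out; rewrite xS.
  by rewrite /c3 (negPf xC) cE ?xi // inE xS xi.
(* For [D = C] this provides a triangle [o] outside [C]; by parity there is a second
   triangle [t], which meets [C]. A component [D] of [C] minus the tripod of [t] that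
   touches all three parts is excluded, as [o] and [t] would both count for [D]. *)
have uniq_tri (D : {set V}) : D \subset C -> conn e D ->
    (forall i, i \in K -> touch e D (part S pi i)) ->
    (forall x, x \in C -> x \notin D -> up x \notin D) ->
    #|[set t | rainbow (c4 D) (tri t)]| = 1.
  move=> DC cD tD upD.
  have class i : i \in K -> part S pi i \subset [set x | c4 D x == index i K].
    move=> iK; apply/subsetP=> x /(c3_part _ _ iK)[xC xi]; rewrite inE /c4.
    by rewrite (negPf (contra (subsetP DC x) xC)) xi.
  have D3 : [set x | c4 D x == 3] = D.
    apply/setP=> x; rewrite inE /c4; case: ifP => // _.
    by rewrite (ltn_eqF (c3_lt x)).
  have nthK i : i < 3 -> exists2 k, k \in K & i = index k K.
    move=> i3; exists (nth 0 K i); first by rewrite mem_nth ?K3.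
    by rewrite index_uniq ?K3.
  apply: tri_uniq => [x|i|i j i4 j4 ij].
  - by rewrite /c4; case: ifP => // _; apply: leqW (c3_lt x).
  - have [->|i3] := eqVneq i 3; first by rewrite D3.
    have [ge4|lt4] := leqP 4 i.
      move=> x y; rewrite inE /c4; case: ifP => _ /eqP E; first by rewrite -E in ge4.
      by have := c3_lt x; rewrite E; lia.
    have [|k kK ik] := nthK i; first by lia.
    (* Each vertex of the class is led to part [k] within the class: outside [C] by absorption,
       inside [C] along its vertical path, which avoids [D] by [upD]. *)
    rewrite ik; apply: (conn_hub _ (class k kK)) => //; first exact: (st_conn st).
    move=> x; rewrite inE /c4; case: ifPn => [_|xD] /eqP ck.
      by have := index_lt3 kK; rewrite -ck.
    have [xC|xC] := boolP (x \in C); last first.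
      have [y yS [cy xy]] := c_hub x xC.
      move: ck; rewrite /c3 (negPf xC) => ck; exists y.
        have := yS; rewrite !inE => /andP[ysS yK]; rewrite ysS /=; apply/eqP.
        by apply: (index_K yK kK); rewrite -ck -cy cE.
      apply: connect_einS xy; apply/subsetP=> z; rewrite in_set in_setC => /andP[zC /eqP cz].
      by rewrite in_set /c4 /c3 (negPf zC) (negPf (contra (subsetP DC z) zC)) cz ck.
    move: ck; rewrite /c3 xC => /(index_K (foot_K xC) kK) fk; move: xC xD fk.
    elim/up_ind: x => [x xS /C_out|x xS IH xC xD fx]; first by rewrite xS.
    have xcl : x \in [set z | c4 D z == index k K].
      by rewrite inE /c4 (negPf xD) /c3 xC fx.
    have ux := up_e (notin_r xS); have uD := upD x xC xD.
    case: (C_nbr xC ux) => [uC|[uS uK]].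
      have [|y yk uy] := IH uC uD; first by rewrite -foot_up.
      exists y => //; apply: connect_trans uy; apply: ein1 => //.
      by rewrite inE /c4 (negPf uD) /c3 uC -foot_up // fx.
    have upk : up x \in part S pi k by rewrite inE uS -footS // -foot_up // fx eqxx.
    by exists (up x) => //; apply: ein1 => //; apply: (subsetP (class k kK)).
  - have [i3|i3] := eqVneq i 3; have [j3|j3] := eqVneq j 3.
    + by rewrite i3 j3 in ij.
    + have [|k kK ->] := nthK j; first by lia.
      by rewrite i3 D3; apply: touchS (tD k kK) => //; apply: class.
    + have [|k kK ->] := nthK i; first by lia.
      by rewrite j3 D3; apply: touch_sym e_sym _; apply: touchS (tD k kK) => //; apply: class.
    + have [|k kK ik] := nthK i; first by lia.
      have [|l lK jl] := nthK j; first by lia.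
      rewrite ik jl; apply: touchS (class k kK) (class l lK) _; apply: K_clique => //.
      by apply: contraNneq ij => kl; rewrite ik jl kl.
have : #|[set t | rainbow (c4 C) (tri t)]| == 1.
  apply/eqP; apply: uniq_tri => //; first exact: conn_comp.
    by move=> i /K_touch.
  by move=> x ->.
case/cards1P=> o oE.
have oP : rainbow (c4 C) (tri o) by have := set11 o; rewrite -oE inE.
have o_out (D : {set V}) i : D \subset C -> i < 3 ->
    exists x, [/\ x \in tri o, x \notin D & c3 x = i].
  move=> DC i3; have /allP/(_ i) := oP; rewrite mem_iota => /(_ i3) /mapP[x xo].
  rewrite /c4; case: ifPn => [_ E|xC E]; first by rewrite E in i3.
  by exists x; split=> //; apply: contra xC; apply: (subsetP DC).
have o3 : rainbow c3 (tri o).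
  apply/allP=> i; rewrite mem_iota => i3.
  by have [x [xo _ <-]] := o_out C i (subxx _) i3; apply: map_f.
have [t t3 to] : exists2 t, rainbow c3 (tri t) & t != o.
  have := tri_even c3 c3_lt; rewrite (cardsD1 o) inE o3 /=.
  case: (set_0Vmem ([set t | rainbow c3 (tri t)] :\ o)) => [->|[t]].
    by rewrite cards0.
  by rewrite !inE => /andP[to tr] _; exists t.
have [x xt xC] : exists2 x, x \in tri t & x \in C.
  apply/exists_inP; apply: contraR to => /exists_inPn noC.
  rewrite -in_set1 -oE inE; apply/allP=> i /(allP t3)/mapP[x xt ->].
  by apply/mapP; exists x => //; rewrite /c4 (negPf (noC x xt)).
(* At the colour of [x] the corner chosen is [x] itself, which ensures that at least one leg starts
   in [C]. *)
pose q j := if j == foot x then x else odflt x [pick y in tri t | c3 y == index j K].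
have qP j : j \in K -> q j \in tri t /\ c3 (q j) = index j K.
  move=> jK; rewrite /q; case: eqP => [->|_]; first by rewrite /c3 xC.
  case: pickP => [y /andP[yt /eqP cy] //|no].
  have /(allP t3)/mapP[y yt cy] : index j K \in iota 0 3 by rewrite mem_iota index_lt3.
  by have := no y; rewrite yt cy eqxx.
have qx : q (foot x) = x by rewrite /q eqxx.
have qC j : j \in K -> foot (q j) = j /\ (q j \in C \/ q j \in S).
  move=> jK; have [qt cq] := qP j jK; have [qjC|qjC] := boolP (q j \in C).
    split; last by left.
    by move: cq; rewrite /c3 qjC => /(index_K (foot_K qjC) jK) ->.
  have [xq|xq] := tri_adj t _ _ xt qt; first by rewrite -xq xC in qjC.
  (* A corner outside [C] is a neighbour of [x] in [C], so it belongs to [S] and not merely to an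
     absorbed class. *)
  have [E|[qS qK]] := C_nbr xC xq; first by rewrite E in qjC.
  split; last by right.
  move: cq; rewrite /c3 (negPf qjC) cE ?inE ?qS // footS //.
  by move/(index_K qK jK) ->.
exists q; split=> //.
- by move=> i j iK jK; apply: (tri_adj t); [have [] := qP i iK | have [] := qP j jK].
- by exists (foot x); rewrite ?qx // foot_K.
move=> z zC zY; set D := component _ z.
have [/allP all_t|/allPn[i iK /touchP nt]] :=
  boolP (all (fun i => [exists x in D, exists y in part S pi i, e x y]) K); last by exists i.
have zS' : z \notin S :|: tripod q by rewrite inE negb_or C_out.
have DC : D \subset C.
  apply/subsetP=> y; rewrite !inE => zy; have := zC; rewrite inE => x0z.
  apply: connect_trans x0z _; apply: connect_einS zy; rewrite setCS; exact: subsetUl.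
have /cards1P[o' o'E] : #|[set t | rainbow (c4 D) (tri t)]| == 1.
  apply/eqP; apply: uniq_tri DC (conn_comp zS') _ _.
    by move=> i iK; apply/touchP; apply: all_t.
  (* If [up y] were in the component [D] and [y] not, then [y] would lie on a leg; but the next
     vertex of a leg is on the leg or in [S], never in [D]. *)
  move=> y yC yD; apply/negP=> uD.
  have yS := C_out yC; have uy := up_e (notin_r yS).
  have [yS'|yS'] := boolP (y \in S :|: tripod q); last first.
    by case/negP: yD; apply: (comp_closed zS' uD yS'); rewrite e_sym.
  have uS' := comp_out zS' uD; move: yS'; rewrite inE (negPf yS) /= => /(tripodP q)[i iK yv].
  case/negP: uS'; rewrite inE; have [->//|uv] := vpath_next yv.
  by apply/orP; right; apply/(tripodP q); exists i.
have inE' t' : rainbow (c4 D) (tri t') -> t' = o'.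
  by move=> h; apply/set1P; rewrite -o'E inE.
case/eqP: to; transitivity o'; last first.
  apply/esym/inE'/allP=> i; rewrite mem_iota => i3.
  have [y [yo yD <-]] := o_out D i DC i3.
  by apply/mapP; exists y => //; rewrite /c4 (negPf yD).
apply: inE'; apply/allP=> i; rewrite mem_iota => i3.
have iK : nth 0 K i \in K by rewrite mem_nth ?K3.
have [qt cq] := qP _ iK; apply/mapP; exists (q (nth 0 K i)) => //.
rewrite /c4 cq index_uniq ?K3 // ifN //.
apply/negP=> /(comp_out zS'); rewrite inE negb_or.
have [_ [qiC|->//]] := qC _ iK.
by rewrite tripod_q ?andbF.
Qed.

End Trichromatic.

Lemma extend_step : exists S1 pi1 par1, state n.+1 S1 pi1 par1 /\ S \proper S1.
Proof.
have [K3|K3] := eqVneq (size K) 3; last exact: extend_le2.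
have [q [h1 h2 h3 h4]] := trichromatic K3.
by apply: (@extend_ex q).
Qed.

End Step.

Lemma state_step n S pi par : state n S pi par -> S != setT ->
  exists S1 pi1 par1, state n.+1 S1 pi1 par1 /\ S \proper S1.
Proof.
move=> st; rewrite -subTset => /subsetPn[x _ xS].
have [K [uK sK tK cK]] := st_comp st xS.
pose K1 := [seq i <- K | [exists u in component S x, exists v in part S pi i, e u v]].
apply: (@extend_step n S pi par st x xS K1).
- exact: filter_uniq.
- by rewrite size_filter (leq_trans (count_size _ _)).
- move=> i; rewrite mem_filter; split=> [/andP[/touchP //]|t].
  by apply/andP; split; [apply/touchP | apply: tK].
- by move=> i j; rewrite !mem_filter => /andP[_ iK] /andP[_ jK]; apply: cK.
Qed.

Lemma tripod_partition : exists n pi par, state n setT pi par.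
Proof.
have h n S pi par : state n S pi par -> exists n pi par, state n setT pi par.
  have [k] := ubnP #|~: S|; elim: k n S pi par => // k IH n S pi par ltk st.
  have [E|ne] := eqVneq S setT; first by exists n, pi, par; rewrite -E.
  have [S1 [pi1 [par1 [st1 /proper_card lt]]]] := state_step st ne.
  apply: (IH n.+1 S1 pi1 par1) => //.
  have := cardsC S; have := cardsC S1; lia.
exact: h state0.
Qed.

End Tripods.

(** * From drawings to layered partitions *)

Section Contraction.
Variable m : nat.
Local Notation torus := ('I_m.+2 * 'I_m.+2)%type.

Lemma torus_conn (x y : torus) : connect (@tadj m) x y.
Proof.
have sym := sym_connect_sym (@tadj_sym m).
suff to0 (z : torus) : connect (@tadj m) (0, 0)%R z.
  by apply: connect_trans (to0 y); rewrite sym.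
have step b (w : torus) : connect (@tadj m) w (w + tdir m (Some b))%R.
  exact/connect1/(tadjE (Some b, w)).
case: z => i j; apply: (@connect_trans _ _ (i, 0)%R).
  rewrite -[i]natr_Zp; elim: (nat_of_ord i) => [|k IH]; first exact: connect0.
  by apply: connect_trans IH _; rewrite -natr1 -shx; apply: (step true).
rewrite -[j]natr_Zp; elim: (nat_of_ord j) => [|k IH]; first exact: connect0.
by apply: connect_trans IH _; rewrite -natr1 -shy; apply: (step false).
Qed.

Variables (V : finType) (beta : torus -> V).

Definition contract : rel V := fun u v =>
  (u != v) && [exists x, exists y, [&& tadj x y, beta x == u & beta y == v]].

Lemma contract_sym : symmetric contract.
Proof.
move=> u v; rewrite /contract eq_sym; congr (_ && _).
by apply/existsP/existsP => -[x /existsP[y /and3P[xy bx by_]]]; exists y;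
  apply/existsP; exists x; rewrite tadj_sym xy bx by_.
Qed.

Lemma contract_tadj x y : tadj x y -> beta x = beta y \/ contract (beta x) (beta y).
Proof.
move=> xy; have [->|ne] := eqVneq (beta x) (beta y); [by left | right].
by rewrite /contract ne /=; apply/existsP; exists x; apply/existsP; exists y; rewrite xy !eqxx.
Qed.

Lemma contract_connect x y : connect (@tadj m) x y -> connect contract (beta x) (beta y).
Proof.
case/connectP=> p; elim: p x => [|z p IH] x /=; first by move=> _ ->.
case/andP=> /contract_tadj xz pp /(IH _ pp); apply: connect_trans.
by case: xz => [->|/connect1].
Qed.

Hypothesis fib_conn : forall v, conn (@tadj m) [set x | beta x == v].

(** Paths of the contraction are lifted edge by edge, moving within a connected fibre from one
    lifted edge to the next. *)
Lemma conn_preim (A : {set V}) : conn contract A -> conn (@tadj m) [set x | beta x \in A].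
Proof.
move=> cA x y; rewrite !inE => xA yA; have := cA _ _ xA yA.
have fibA z w : beta z \in A -> beta z = beta w ->
    connect (ein (@tadj m) [set x | beta x \in A]) z w.
  move=> zA zw; have := @fib_conn (beta w) z w.
  rewrite !inE zw eqxx => /(_ isT isT); apply: connect_einS.
  by apply/subsetP=> t; rewrite !inE => /eqP ->; rewrite -zw.
case/connectP=> p; elim: p x xA => [|v p IH] x xA /=.
  by move=> _ E; apply: fibA.
case/andP=> /and3P[_ vA /andP[_ /existsP[a /existsP[b /and3P[ab /eqP ax /eqP bv]]]]] pp.
rewrite -{}bv in vA pp *.
move=> /(IH b vA pp); apply: connect_trans.
apply: connect_trans (_ : connect _ x a) _; first by apply: fibA; rewrite ?ax.
by apply: ein1 => //; rewrite inE ?ax.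
Qed.

Hypothesis beta_axes : forall x y, x \in axes m -> y \in axes m -> beta x = beta y.

Lemma contract_spherical : spherical contract (fun t : ttri m => map beta (corners t)).
Proof.
have rbE (c : V -> nat) : [set t | rainbow c (map beta (corners t))] =
                          [set t | rainbow012 (c \o beta) t].
  by apply/setP=> t; rewrite !inE /rainbow /rainbow012 map_comp.
split.
- move=> t _ _ /mapP[x xt ->] /mapP[y yt ->].
  by have [->|/contract_tadj//] := corners_adj xt yt; left.
- by move=> c c3; rewrite rbE; apply: rainbow012_even => x; apply: c3.
- move=> c c4 cc ct; rewrite rbE; apply: rainbow012_unique.
  + by move=> x y xa ya /=; rewrite (beta_axes xa ya).
  + move=> i; have := conn_preim (cc i).
    by rewrite (_ : [set x | beta x \in _] = [set x | (c \o beta) x == i]) //;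
        apply/setP=> x; rewrite !inE.
  + by move=> x; apply: c4.
  + move=> i j i4 j4 ij; have [u [v [ui vj /andP[_ /existsP[a /existsP[b /and3P[ab /eqP ax
      /eqP bv]]]]]]] := ct i j i4 j4 ij.
    by exists a, b; move: ui vj; rewrite !inE /= ax bv.
Qed.

End Contraction.

Definition layered_partition (G : sgraph) n (pi dep : G -> nat) (par : nat -> seq nat) :=
  [/\ 0 < n /\ forall u, pi u < n,
      forall u v, adj u v -> [\/ pi u = pi v, pi u \in par (pi v) | pi v \in par (pi u)],
      forall u v, adj u v -> dep u <= (dep v).+1,
      forall i k, #|[set u | (pi u == i) && (dep u == k)]| <= 3 &
      [/\ forall i, size (par i) <= 3, forall i j, i < n -> j \in par i -> j < i &
          forall i p q, i < n -> p \in par i -> q \in par i -> p < q -> p \in par q]].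

(** A minor model of [G] in the triangulated torus, with branch sets off the axes. *)
Definition torus_model (G : sgraph) m (B : G -> {set 'I_m.+2 * 'I_m.+2}) :=
  [/\ forall u, B u != set0,
      forall u, conn (@tadj m) (B u),
      forall u w x, x \in B u -> x \in B w -> u = w,
      forall u, [disjoint B u & axes m] &
      forall u w, adj u w -> touch (@tadj m) (B u) (B w)].

(** The branch sets and the axes are seeds from which all cells are absorbed. The contraction has
    vertex set [option G], with [None] for the axes; it is connected because the torus is.
    Restricting its partition and depths to [G] can only remove vertices from the parts. *)
Lemma torus_partition (G : sgraph) m (B : G -> {set 'I_m.+2 * 'I_m.+2}) :
  torus_model B -> exists n (pi dep : G -> nat) par, layered_partition n pi dep par.
Proof.
move=> [B0 Bc Bd Bax Badj].
pose seeds := axes m :|: \bigcup_u B u.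
pose c0 x := [pick u | x \in B u].
have seedB x u : x \in B u -> x \in seeds by move=> xB; rewrite inE; apply/orP; right;
    apply/bigcupP; exists u.
have c0B x u : x \in B u -> c0 x = Some u.
  rewrite /c0; case: pickP => [w xw xu|/(_ u) -> //]; by rewrite (Bd _ _ _ xw xu).
have c0ax x : x \in axes m -> c0 x = None.
  move=> xa; rewrite /c0; case: pickP => // u xu.
  by have := Bax u; rewrite disjoints_subset => /subsetP/(_ x xu); rewrite inE xa.
have ax0 : (0, 0)%R \in axes m by rewrite inE eqxx.
have [||beta [betaE beta_hub]] := @absorb _ (@tadj m) _ setT seeds c0.
- move=> x _; exists (0, 0)%R; first by rewrite inE ax0.
  have := torus_conn x (0, 0)%R; apply: connect_sub => u v uv; apply: ein1; by rewrite ?inE.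
- exact: subsetT.
have beta_ax x : x \in axes m -> beta x = None by move=> xa; rewrite betaE ?c0ax // inE xa.
have betaB x u : x \in B u -> beta x = Some u by move=> xB; rewrite (betaE _ (seedB _ _ xB));
    apply: c0B.
have axes_conn : conn (@tadj m) (axes m).
  have to0 x : x \in axes m -> connect (ein (@tadj m) (axes m)) (0, 0)%R x.
    have step b (w : 'I_m.+2 * 'I_m.+2) : w \in axes m -> (w + tdir m (Some b))%R \in axes m ->
        connect (ein (@tadj m) (axes m)) w (w + tdir m (Some b))%R.
      by move=> wa wa'; apply: ein1 => //; apply: (tadjE (Some b, w)).
    case: x => i j; rewrite inE /= => /orP[]/eqP->.
      rewrite -[j]natr_Zp; elim: (nat_of_ord j) => [|k IH]; first exact: connect0.
      by apply: connect_trans IH _; rewrite -natr1 -shy; apply: (step false);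
          rewrite inE /= ?addr0 ?eqxx.
    rewrite -[i]natr_Zp; elim: (nat_of_ord i) => [|k IH]; first exact: connect0.
    by apply: connect_trans IH _; rewrite -natr1 -shx; apply: (step true);
        rewrite inE /= ?addr0 ?eqxx ?orbT.
  move=> x y /to0 x0 /to0 y0; apply: connect_trans y0; rewrite ein_csym //; exact: tadj_sym.
have fib v : conn (@tadj m) [set x | beta x == v].
  have hub (A0 : {set 'I_m.+2 * 'I_m.+2}) : conn (@tadj m) A0 ->
      (forall x, x \in A0 -> beta x = v) -> (forall x, x \in seeds -> beta x = v -> x \in A0) ->
      conn (@tadj m) [set x | beta x == v].
    move=> cA A0v A0s; apply: (conn_hub (@tadj_sym m) _ cA).
      by apply/subsetP=> x /A0v; rewrite inE => ->.
    move=> x; rewrite inE => /eqP xv; have [y ys xy] := beta_hub x (in_setT _).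
    have sub : [set z in setT | beta z == beta x] = [set z | beta z == v].
      by apply/setP=> z; rewrite !inE xv.
    rewrite sub in xy; exists y => //; apply: A0s => //.
    have : y \in [set z | beta z == v] by apply: connect_ein_mem xy; rewrite inE xv.
    by rewrite inE => /eqP.
  have seed_cases x : x \in seeds -> x \in axes m \/ exists u, x \in B u.
    by rewrite inE => /orP[|/bigcupP[u _ xu]]; [left | right; exists u].
  case: v hub => [u|] hub.
    apply: (hub (B u)) => // [x|x xs]; first exact: betaB.
    by case: (seed_cases x xs) => [/beta_ax -> //|[w xw]]; rewrite (betaB _ _ xw) => -[<-].
  apply: (hub (axes m)) => // x xs.
  by case: (seed_cases x xs) => // -[w xw]; rewrite (betaB _ _ xw).
have csym := contract_sym beta.
have sph := contract_spherical fib (fun x y xa ya => etrans (beta_ax x xa) (esym (beta_ax y ya))).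
have cconn v : connect (contract beta) None v.
  have -> : None = beta (0, 0)%R by rewrite beta_ax.
  have [x <-] : exists x, beta x = v.
    case: v => [u|]; last by exists (0, 0)%R; apply: beta_ax.
    by have /set0Pn[x xu] := B0 u; exists x; apply: betaB.
  exact/contract_connect/torus_conn.
have [dep [up [dep_r up_dep lip]]] := bfs_tree csym cconn.
have [||n [pi [par st]]] := tripod_partition csym cconn dep_r _ _ sph (up := up).
- by move=> v /up_dep[].
- by move=> v /up_dep[].
have adj_c u w : adj u w -> contract beta (Some u) (Some w).
  move=> uw; have [x [y [xu yw xy]]] := Badj u w uw.
  have := contract_tadj beta xy; rewrite (betaB _ _ xu) (betaB _ _ yw).
  by case=> // -[E]; rewrite E adj_irr in uw.
exists n, (fun u => pi (Some u)), (fun u => dep (Some u)), par; split.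
- have pi_lt x : pi x < n by apply: (st_pi st); rewrite inE.
  by split=> [|u //]; apply: leq_ltn_trans (pi_lt None).
- move=> u w uw; have cuw := adj_c _ _ uw.
  have [lt|gt|->] := ltngtP (pi (Some u)) (pi (Some w)); last by constructor 1.
    by constructor 2; apply: (st_edge st); rewrite ?inE.
  by constructor 3; apply: (st_edge st); rewrite ?inE // csym.
- by move=> u w /adj_c/lip.
- move=> i k; apply: leq_trans (st_width st i k).
  rewrite -(card_imset _ Some_inj); apply: subset_leq_card.
  by apply/subsetP=> _ /imsetP[u + ->]; rewrite !inE.
- split; [exact: (st_par st) | exact: (st_par_lt st) | exact: (st_clique st)].
Qed.

(** * Branch sets of cells from the discretised arcs *)

Section Model.
Variables (G : sgraph) (h N : nat) (X Y : G -> G -> nat -> nat).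
Hypothesis XY_bound : forall x y k, oriented x y -> k <= h.*2 ->
  0 < X x y k < N /\ 0 < Y x y k < N.
Hypothesis XY_step : forall x y k, oriented x y -> k < h.*2 ->
  [/\ X x y k.+1 <= (X x y k).+1, X x y k <= (X x y k.+1).+1,
      Y x y k.+1 <= (Y x y k).+1 & Y x y k <= (Y x y k.+1).+1].
Hypothesis XY_ends : forall x y, oriented x y ->
  [/\ X x y 0 = X x x 0, Y x y 0 = Y x x 0,
      X x y h.*2 = X y y 0 & Y x y h.*2 = Y y y 0].
Hypothesis XY_sep : forall (p p' : G * G * bool) k l k' l',
  oriented p.1.1 p.1.2 -> oriented p'.1.1 p'.1.2 -> owner p != owner p' -> p.1 != p'.1 ->
  in_half h p.2 k -> in_half h p.2 l -> l <= k <= l.+1 ->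
  in_half h p'.2 k' -> in_half h p'.2 l' -> l' <= k' <= l'.+1 ->
  ~ (X p.1.1 p.1.2 k = X p'.1.1 p'.1.2 k' /\ Y p.1.1 p.1.2 l = Y p'.1.1 p'.1.2 l').

Local Notation torus := ('I_N.+2 * 'I_N.+2)%type.
Let pt a b : torus := (inord a, inord b).
(* Only one coordinate changes at a time, so that consecutive cells are adjacent. *)
Let c x y j : torus := pt (X x y (uphalf j)) (Y x y j./2).
Let walk_len := h.*2.*2.

Lemma pt_inj a b a' b' : a < N -> b < N -> a' < N -> b' < N ->
  pt a b = pt a' b' -> a = a' /\ b = b'.
Proof.
move=> aN bN aN' bN' [E1 E2].
have := congr1 val E1; have := congr1 val E2; rewrite /= !inordK; lia.
Qed.

Lemma tadj_x a b : a < N -> tadj (pt a b) (pt a.+1 b).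
Proof.
move=> aN; have := tadjE ((Some true, pt a b) : tedge N).
rewrite /esrc /etgt /= shx; congr (tadj _ (_, _)).
by apply: val_inj; rewrite /= !inordK ?modn_small; lia.
Qed.

Lemma tadj_y a b : b < N -> tadj (pt a b) (pt a b.+1).
Proof.
move=> bN; have := tadjE ((Some false, pt a b) : tedge N).
rewrite /esrc /etgt /= shy; congr (tadj _ (_, _)).
by apply: val_inj; rewrite /= !inordK ?modn_small; lia.
Qed.

Lemma close_cases a b : a <= b.+1 -> b <= a.+1 -> [\/ a = b, a = b.+1 | b = a.+1].
Proof.
move=> ab ba; have [->|[->|->]] : a = b \/ a = b.+1 \/ b = a.+1 by lia.
- by constructor 1.
- by constructor 2.
- by constructor 3.
Qed.

Lemma c_step x y j : oriented x y -> j < walk_len ->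
    c x y j = c x y j.+1 \/ tadj (c x y j) (c x y j.+1).
Proof.
move=> o jt; rewrite /c; have := odd_double_half j; case: (odd j) => jE.
  have -> : uphalf j.+1 = uphalf j by lia.
  have -> : (j.+1)./2 = (j./2).+1 by lia.
  have lt : j./2 < h.*2 by move: jt; rewrite /walk_len; lia.
  have [_ _ s1 s2] := XY_step o lt; have [_ b1] := XY_bound o (ltnW lt);
      have [_ b2] := XY_bound o lt.
  case: (close_cases s1 s2) => [->|->|->]; first by left.
    by right; apply: tadj_y; lia.
  by right; rewrite tadj_sym; apply: tadj_y; lia.
have -> : uphalf j.+1 = (uphalf j).+1 by lia.
have -> : (j.+1)./2 = j./2 by lia.
have lt : uphalf j < h.*2 by move: jt; rewrite /walk_len; lia.
have [s1 s2 _ _] := XY_step o lt; have [b1 _] := XY_bound o (ltnW lt);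
    have [b2 _] := XY_bound o lt.
case: (close_cases s1 s2) => [->|->|->]; first by left.
  by right; apply: tadj_x; lia.
by right; rewrite tadj_sym; apply: tadj_x; lia.
Qed.

Definition first_cells x y : {set torus} := [set z | [exists j : 'I_(h.*2).+1, z == c x y j]].
(** The two halves of one discretised arc may share cells. The second half therefore starts after
    the last visit to a cell of the first, which makes the halves disjoint while their cells at this
    cut stay adjacent. *)
Definition last_index x y := \max_(j < walk_len.+1 | c x y j \in first_cells x y) j.
Definition last_cells x y : {set torus} :=
  [set z | [exists j : 'I_walk_len.+1, (last_index x y < j) && (z == c x y j)]].

Lemma first_cellsP x y z : reflect (exists2 j, j <= h.*2 & z = c x y j) (z \in first_cells x y).
Proof.
rewrite inE; apply: (iffP existsP) => [[j /eqP ->]|[j jh ->]].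
  by exists j => //; rewrite -ltnS.
by exists (Ordinal (jh : j < (h.*2).+1)); rewrite /= eqxx.
Qed.

Lemma last_cellsP x y z : reflect (exists j, [/\ last_index x y < j,
    j <= walk_len & z = c x y j]) (z \in last_cells x y).
Proof.
rewrite inE; apply: (iffP existsP) => [[j /andP[lj /eqP ->]]|[j [lj jt ->]]].
  by exists j; split=> //; rewrite -ltnS.
by exists (Ordinal (jt : j < walk_len.+1)); rewrite /= lj eqxx.
Qed.

Lemma last_index_max x y j : j <= walk_len -> c x y j \in first_cells x y -> j <= last_index x y.
Proof.
move=> jt cj.
exact: (@leq_bigmax_cond _ (fun j : 'I_walk_len.+1 => c x y j \in first_cells x y) val
    (Ordinal (jt : j < walk_len.+1))).
Qed.

Lemma last_index_ge x y : h.*2 <= last_index x y.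
Proof. by apply: last_index_max; [rewrite /walk_len; lia | apply/first_cellsP; exists h.*2]. Qed.

Lemma last_indexP x y : last_index x y <= walk_len /\ c x y (last_index x y) \in first_cells x y.
Proof.
have [|j jP jE] := @eq_bigmax_cond _ (fun j : 'I_walk_len.+1 => c x y j \in first_cells x y) val.
  apply/card_gt0P; exists ord0; apply/first_cellsP; by exists 0.
have E : last_index x y = j by exact: jE.
by rewrite E; split; [rewrite -ltnS | exact: jP].
Qed.

Lemma first_last_disjoint x y z : z \in first_cells x y -> z \in last_cells x y -> False.
Proof.
move=> zh /last_cellsP[j [lj jt zE]]; rewrite zE in zh.
by have := last_index_max jt zh; rewrite leqNgt lj.
Qed.

Definition model u : {set torus} :=
  [set z | [exists y, oriented u y && (z \in first_cells u y)] ||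
           [exists x, [&& x != u, oriented x u & z \in last_cells x u]]].

Definition piece (p : G * G * bool) := if p.2 then last_cells p.1.1 p.1.2 else first_cells
    p.1.1 p.1.2.

Lemma modelP u z : z \in model u -> exists p, [/\ oriented p.1.1 p.1.2,
    owner p = u & z \in piece p].
Proof.
rewrite inE => /orP[/existsP[y /andP[o zh]]|/existsP[x /and3P[_ o zt]]].
  by exists (u, y, false).
by exists (x, u, true).
Qed.

Lemma pieceP p z : z \in piece p -> exists k l,
  [/\ in_half h p.2 k, in_half h p.2 l, l <= k <= l.+1 & z = pt (X p.1.1 p.1.2 k) (Y p.1.1
      p.1.2 l)].
Proof.
rewrite /piece /in_half; case: p.2 => [/last_cellsP[j [lj jt ->]]|/first_cellsP[j jh ->]];
  exists (uphalf j), (j./2); split=> //; try lia.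
- by have := last_index_ge p.1.1 p.1.2; move: jt; rewrite /walk_len; lia.
- by have := last_index_ge p.1.1 p.1.2; move: jt; rewrite /walk_len; lia.
Qed.

Lemma in_half_le s k : in_half h s k -> k <= h.*2.
Proof. by rewrite /in_half; case: s => [/andP[]|] //; lia. Qed.

Lemma piece_sep p p' z : oriented p.1.1 p.1.2 -> oriented p'.1.1 p'.1.2 -> owner p != owner p' ->
  z \in piece p -> z \in piece p' -> False.
Proof.
move=> o o' ne zp zp'; have [E|ne1] := eqVneq p.1 p'.1.
  move: p p' ne E zp zp' {o o'} => [a b] [a' b'] /= + E; rewrite -E.
  rewrite /owner /piece /=; case: b; case: b'; rewrite ?eqxx // => _ zp zp'.
    exact: first_last_disjoint zp' zp.
  exact: first_last_disjoint zp zp'.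
have [k [l [kp lp kl zE]]] := pieceP zp; have [k' [l' [kp' lp' kl' zE']]] := pieceP zp'.
have [/andP[_ b1] _] := XY_bound o (in_half_le kp).
have [_ /andP[_ b2]] := XY_bound o (in_half_le lp).
have [/andP[_ b3] _] := XY_bound o' (in_half_le kp').
have [_ /andP[_ b4]] := XY_bound o' (in_half_le lp').
apply: (XY_sep o o' ne ne1 kp lp kl kp' lp' kl').
by apply: pt_inj => //; rewrite -zE -zE'.
Qed.

Lemma orientedxx (u : G) : oriented u u.
Proof. by rewrite /oriented eqxx. Qed.

Lemma c_start x y : oriented x y -> c x y 0 = c x x 0.
Proof. by move=> o; have [e1 e2 _ _] := XY_ends o; rewrite /c /= e1 e2. Qed.

Lemma c_end x y : oriented x y -> c x y walk_len = c y y 0.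
Proof.
move=> o; have [_ _ e3 e4] := XY_ends o.
by rewrite /c /walk_len uphalf_double doubleK /= e3 e4.
Qed.

Lemma model_first u y z : oriented u y -> z \in first_cells u y -> z \in model u.
Proof. by move=> o zh; rewrite inE; apply/orP; left; apply/existsP; exists y; rewrite o. Qed.

Lemma model_last u x z : x != u -> oriented x u -> z \in last_cells x u -> z \in model u.
Proof. by move=> xu o zt; rewrite inE; apply/orP; right; apply/existsP; exists x;
    rewrite xu o. Qed.

Lemma center_model u : c u u 0 \in model u.
Proof. by apply: (@model_first u u); [exact: orientedxx | apply/first_cellsP; exists 0]. Qed.

Lemma walk_connect (A : {set torus}) x y i j : oriented x y -> i <= j -> j <= walk_len ->
  (forall k, i <= k <= j -> c x y k \in A) -> connect (ein (@tadj N) A) (c x y i) (c x y j).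
Proof.
move=> o; elim: j => [|j IH] ij jt inA.
  by move: ij; rewrite leqn0 => /eqP->; apply: connect0.
move: ij; rewrite leq_eqVlt => /orP[/eqP->|ij]; first exact: connect0.
apply: connect_trans (IH ij (ltnW jt) _) _.
  by move=> k kj; apply: inA; lia.
have [->|a] := c_step o jt; first exact: connect0.
by apply: ein1 => //; apply: inA; lia.
Qed.

(** Otherwise the end of the walk, the cell of [y], would be a cell of the first half, which [x]
    owns; the constant arc at [y] is separated from that half. *)
Lemma last_index_lt x y : x != y -> oriented x y -> last_index x y < walk_len.
Proof.
move=> xy o; have [le lh] := last_indexP x y; rewrite ltn_neqAle le andbT.
apply/negP=> /eqP E; rewrite E c_end // in lh.
apply: (@piece_sep (x, y, false) (y, y, false) (c y y 0)) => //.
  exact: orientedxx.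
by rewrite /piece /=; apply/first_cellsP; exists 0.
Qed.

Lemma model_torus : torus_model model.
Proof.
split.
- by move=> u; apply/set0Pn; exists (c u u 0); apply: center_model.
- move=> u; apply: (@conn_hub _ _ (@tadj_sym N) [set c u u 0]).
  + by rewrite sub1set center_model.
  + by move=> x y; rewrite !inE => /eqP-> /eqP->; apply: connect0.
  move=> z zu; exists (c u u 0); first by rewrite inE.
  move: zu; rewrite inE => /orP[/existsP[y /andP[o /first_cellsP[j jh ->]]]|/existsP[x
      /and3P[xu o /last_cellsP[j [lj jt ->]]]]].
    rewrite ein_csym; last exact: (@tadj_sym N).
    rewrite -(c_start o); apply: walk_connect => //; first by rewrite /walk_len; lia.
    by move=> k kj; apply: model_first o _; apply/first_cellsP; exists k => //; lia.
  rewrite -(c_end o); apply: walk_connect => // k kj.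
  by apply: model_last xu o _; apply/last_cellsP; exists k; split=> //; lia.
- move=> u w z zu zw; apply/eqP; apply: contraT => uw.
  have [p [o pu zp]] := modelP zu; have [p' [o' pw zp']] := modelP zw.
  by case: (piece_sep o o' _ zp zp'); rewrite pu pw.
- move=> u; rewrite disjoints_subset; apply/subsetP=> z zu; rewrite !inE negb_or.
  have [p [o _ /pieceP[k [l [kp lp _ ->]]]]] := modelP zu.
  have [b1 _] := XY_bound o (in_half_le kp); have [_ b2] := XY_bound o (in_half_le lp).
  by rewrite -!val_eqE /= !inordK; lia.
have or_adj u w : oriented u w -> u != w -> touch (@tadj N) (model u) (model w).
  move=> o uw; have lt := last_index_lt uw o; have [_ lh] := last_indexP u w.
  exists (c u w (last_index u w)), (c u w (last_index u w).+1).
  have tl : c u w (last_index u w).+1 \in last_cells u w by apply/last_cellsP;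
      exists (last_index u w).+1.
  split; [exact: model_first lh | exact: model_last tl |].
  have [E|//] := c_step o lt.
  by case: (first_last_disjoint lh); rewrite E.
move=> u w uw; have ne : u != w by apply: contraTneq uw => ->; rewrite adj_irr.
have [lt|gt|E] := ltngtP (enum_rank u) (enum_rank w).
- by apply: or_adj; rewrite // /oriented uw lt orbT.
- apply: touch_sym (@tadj_sym N) _; apply: or_adj; last by rewrite eq_sym.
  by rewrite /oriented adj_sym uw gt orbT.
- by move: ne; rewrite (enum_rank_inj (val_inj E)) eqxx.
Qed.

End Model.

Lemma planar_partition (G : sgraph) : planar G ->
  exists n (pi dep : G -> nat) par, layered_partition n pi dep par.
Proof.
by move=> /planar_walks[h [N [X [Y [h1 h2 h3 h4]]]]];
    apply: torus_partition (model_torus h1 h2 h3 h4).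
Qed.

(** * Clique lifts of layered partitions *)

Section ParentTree.
Variables (n : nat) (tp : 'I_n -> 'I_n).
Hypothesis tp_le : forall i : 'I_n, tp i <= i.
Hypothesis tp_lt : forall i : 'I_n, 0 < i -> tp i < i.

Definition parent_rel : rel 'I_n := fun i j => (i != j) && ((tp i == j) || (tp j == i)).
Lemma parent_rel_sym : symmetric parent_rel.
Proof. by move=> i j; rewrite /parent_rel eq_sym orbC. Qed.
Lemma parent_rel_irr : irreflexive parent_rel.
Proof. by move=> i; rewrite /parent_rel eqxx. Qed.
Definition parent_graph := @SGraph 'I_n parent_rel parent_rel_sym parent_rel_irr.

Lemma parent_rel_tp (i : 'I_n) : 0 < i -> parent_rel i (tp i).
Proof. by move=> i0; rewrite /parent_rel eqxx -val_eqE neq_ltn tp_lt // orbT. Qed.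

Lemma parent_rel_lt i j : parent_rel i j -> j < i -> j = tp i.
Proof.
case/andP=> _ /orP[/eqP-> //|/eqP <-] lt.
by have := tp_le j; rewrite leqNgt lt.
Qed.

(** The largest vertex of a cycle has two smaller neighbours on it, and both must be its parent, so
    its successor and predecessor coincide. This is impossible on a cycle with more than two
    vertices. *)
Lemma parent_tree : 0 < n -> is_tree parent_graph.
Proof.
move=> n0; split; first by exists (Ordinal n0).
split.
  have to0 (i : 'I_n) : connect parent_rel (Ordinal n0) i.
    have [k] := ubnP (i : nat); elim: k i => // k IH i lti.
    have [i0|i0] := posnP i; first by rewrite (_ : i = Ordinal n0) ?connect0 //; apply: val_inj.
    apply: connect_trans (IH (tp i) _) _; first by have := tp_lt i0; lia.
    by apply: connect1; rewrite parent_rel_sym parent_rel_tp.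
  move=> i j; apply: connect_trans (to0 j).
  by rewrite (sym_connect_sym parent_rel_sym).
move=> s us ss; apply/negP=> cs.
have [x xs xmax] : exists2 x, x \in s & forall y, y \in s -> y <= x.
  case: s ss {us cs} => // z s _; case: (@arg_maxnP _ z (mem (z :: s)) val) => [|x xs xm].
    exact: mem_head.
  by exists x.
have nx : next s x = tp x.
  have e := next_cycle cs xs; apply: (parent_rel_lt e).
  have := xmax (next s x); rewrite mem_next xs leq_eqVlt => /(_ isT) /orP[/eqP/val_inj E|//].
  by move: e; rewrite E /= parent_rel_irr.
have px : prev s x = tp x.
  have e := prev_cycle cs xs; rewrite /= parent_rel_sym in e; apply: (parent_rel_lt e).
  have := xmax (prev s x); rewrite mem_prev xs leq_eqVlt => /(_ isT) /orP[/eqP/val_inj E|//].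
  by move: e; rewrite E parent_rel_irr.
have [k s' rE] := rot_to xs.
have := next_prev us x; rewrite px -nx -2!(next_rot k us) rE.
have : uniq (x :: s') by rewrite -rE rot_uniq.
have : 2 < size (x :: s') by rewrite -rE size_rot.
case: s' {rE} => [|y [|z s']] //= _ /and4P[xyz _ _ _].
move: xyz; rewrite !inE !negb_or => /and3P[xy xz _].
by rewrite eqxx eq_sym (negPf xy) eqxx => zx; rewrite zx eqxx in xz.
Qed.
End ParentTree.

(** * Descents to parents and the bags of a tree decomposition *)

Section Descent.
Variables (n : nat) (P : 'I_n -> {set 'I_n}).
Hypothesis P_card : forall i, #|P i| <= 3.
Hypothesis P_lt : forall i j, j \in P i -> j < i.
Hypothesis P_clique : forall i p q, p \in P i -> q \in P i -> p < q -> p \in P q.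

Fixpoint reach s i : {set 'I_n} :=
  i |: if s is s'.+1 then \bigcup_(j in P i) reach s' j else set0.
Definition reachs s (A : {set 'I_n}) := \bigcup_(i in A) reach s i.

Lemma reach_refl s i : i \in reach s i.
Proof. by case: s => [|s] /=; rewrite !inE eqxx. Qed.

Lemma reachS_step s i j x : j \in P i -> x \in reach s j -> x \in reach s.+1 i.
Proof. by move=> ji xj; rewrite /= inE; apply/orP; right; apply/bigcupP; exists j. Qed.

Lemma reachSP s i x : x \in reach s.+1 i -> x = i \/ exists2 j, j \in P i & x \in reach s j.
Proof. by rewrite /= !inE => /orP[/eqP->|/bigcupP[j ji xj]]; [left | right; exists j]. Qed.

Lemma reach_leq s t i : s <= t -> reach s i \subset reach t i.
Proof.
elim: s t i => [|s IH] [|t] i //= st.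
  by rewrite setU0 sub1set !inE eqxx.
apply: setUS; apply/bigcupsP=> j ji; apply: subset_trans (IH t j st) _.
exact: bigcup_sup.
Qed.

Lemma reach_closed s i j x : i \in reach 1 j -> x \in reach s i -> x \in reach s.+1 j.
Proof.
move=> /reachSP[->|[k kj ik]]; first exact/subsetP/reach_leq.
have -> : i = k by move: ik; rewrite /= setU0 inE => /eqP.
exact: reachS_step.
Qed.

(** The increments 3, 2, 1 of [weight2] and 6, 3, 1 of [weight3] make the induction step tight:
    exchanging the largest element for its three parents gains 1 + 3 at the second level and 1 + 3 +
    6 at the third. *)
Definition weight2 k := nth 0 [:: 0; 3; 5; 6] k.
Definition weight3 k := nth 0 [:: 0; 6; 9; 10] k.

(* Removing the largest element [x] of the clique [A1] and passing to its parents
   loses only [x] itself and decreases the weighted sum of the sizes. The total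
   3 + 6 + 10 for three parents is 'C(6, 3) - 1, the bound for 3-trees. *)
Lemma reach_levels b (A1 A2 A3 : {set 'I_n}) :
  A3 \subset A2 -> A2 \subset A1 -> #|A1| <= 3 ->
  (forall x, x \in A1 -> x < b) ->
  (forall x y, x \in A1 -> y \in A1 -> x < y -> x \in P y) ->
  #|reachs 0 A1 :|: reachs 1 A2 :|: reachs 2 A3| <=
    #|A1| + weight2 #|A2| + weight3 #|A3|.
Proof.
elim: b A1 A2 A3 => [|b IH] A1 A2 A3 s32 s21 A1_3 A1b A1c.
  have E1 : A1 = set0 by apply/setP=> x; rewrite inE; apply/negP=> /A1b.
  move: s21; rewrite E1 subset0 => /eqP E2; move: s32; rewrite E2 subset0 => /eqP ->.
  by rewrite /reachs !big_set0 !setU0 cards0.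
have [[x xA1 xb]|no] := (@exists_inP _ (mem A1) (fun x => val x == b)); last first.
  apply: IH => // x xA1; have := A1b x xA1; rewrite ltnS leq_eqVlt => /orP[xb|//].
  by case: no; exists x.
have ltx y : y \in A1 -> y != x -> y < x.
  by move=> yA1 yx; have := A1b y yA1; rewrite (eqP xb) ltnS leq_eqVlt -(eqP xb) val_eqE
      (negPf yx).
have yP y : y \in A1 -> y != x -> y \in P x by move=> yA1 yx; apply: A1c => //; apply: ltx.
have Pb y : y \in P x -> y < b by move=> /P_lt; rewrite (eqP xb).
have Pc y z : y \in P x -> z \in P x -> y < z -> y \in P z by apply: P_clique.
have R0 s y : y \in reach s y by apply: reach_refl.
have c21 := subset_leq_card s21; have c32 := subset_leq_card s32.
have Px3 := P_card x.
have bound (B1 B2 B3 : {set 'I_n}) k : #|reachs 0 B1 :|: reachs 1 B2 :|: reachs 2 B3| <= k ->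
    reachs 0 A1 :|: reachs 1 A2 :|: reachs 2 A3 \subset x |: (reachs 0 B1 :|: reachs 1 B2 :|:
        reachs 2 B3) ->
    #|reachs 0 A1 :|: reachs 1 A2 :|: reachs 2 A3| <= k.+1.
  move=> le /subset_leq_card/leq_trans; apply; rewrite cardsU1 -[k.+1]add1n.
  by apply: leq_add le; apply: leq_b1.
have in_reachs s y z (A : {set 'I_n}) : z \in A -> y \in reach s z -> y \in reachs s A.
  by move=> zA yz; apply/bigcupP; exists z.
have D1 (A : {set 'I_n}) : x \in A -> #|A| = #|A :\ x|.+1 by move=> xA; rewrite (cardsD1 x) xA.
have [xA3|xA3] := boolP (x \in A3).
  have sub3 : A3 :\ x \subset P x.
    apply/subsetP=> y; rewrite !inE => /andP[yx yA3].
    by apply: yP => //; apply: (subsetP s21); apply: (subsetP s32).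
  have ih := IH (P x) (P x) (A3 :\ x) sub3 (subxx _) Px3 Pb Pc.
  apply: leq_trans (bound _ _ _ _ ih _) _.
    apply/subsetP=> y; rewrite in_setU1 !in_setU => /orP[/orP[]|] /bigcupP[z zA yz].
    - have [E|zx] := eqVneq z x; first by move: yz; rewrite E /= !inE orbF => ->.
      by rewrite (in_reachs _ _ _ _ (yP _ zA zx) yz) orbT.
    - have [E|zx] := eqVneq z x; last by rewrite (in_reachs _ _ _ _ (yP _ (subsetP s21 _ zA)
        zx) yz) !orbT.
      move: yz; rewrite E => /reachSP[->|[w wx yw]]; first by rewrite eqxx.
      by rewrite (in_reachs _ _ _ _ wx yw) orbT.
    - have [E|zx] := eqVneq z x.
        move: yz; rewrite E => /reachSP[->|[w wx yw]]; first by rewrite eqxx.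
        by rewrite (in_reachs _ _ _ _ wx yw) !orbT.
      by rewrite (in_reachs 2 y z (A3 :\ x)) ?orbT // !inE zx.
  move: (D1 _ xA3) (D1 _ (subsetP s32 _ xA3)) (D1 _ xA1) c21 c32 A1_3 Px3.
  move: #|A3 :\ x| #|A2 :\ x| #|A1 :\ x| #|A3| #|A2| #|A1| #|P x| => k3 k2 k1 ? ? ? p -> -> ->.
  by case: p => [|[|[|[|p]]]]; case: k3 => [|[|[|k3]]]; case: k2 => [|[|[|k2]]];
      case: k1 => [|[|[|k1]]].
have [xA2|xA2] := boolP (x \in A2).
  have sub2 : A2 :\ x \subset P x.
    by apply/subsetP=> y; rewrite !inE => /andP[yx yA2]; apply: yP => //; apply: (subsetP s21).
  have sub3 : A3 \subset A2 :\ x by rewrite subsetD1 s32.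
  have ih := IH (P x) (A2 :\ x) A3 sub3 sub2 Px3 Pb Pc.
  apply: leq_trans (bound _ _ _ _ ih _) _.
    apply/subsetP=> y; rewrite in_setU1 !in_setU => /orP[/orP[]|] /bigcupP[z zA yz].
    - have [E|zx] := eqVneq z x; first by move: yz; rewrite E /= !inE orbF => ->.
      by rewrite (in_reachs _ _ _ _ (yP _ zA zx) yz) orbT.
    - have [E|zx] := eqVneq z x; last by rewrite (in_reachs 1 y z (A2 :\ x)) ?orbT // !inE zx.
      move: yz; rewrite E => /reachSP[->|[w wx yw]]; first by rewrite eqxx.
      by rewrite (in_reachs _ _ _ _ wx yw) orbT.
    - by rewrite (in_reachs _ _ _ _ zA yz) !orbT.
  have c32' := subset_leq_card sub3.
  move: (D1 _ xA2) (D1 _ xA1) c21 c32' A1_3 Px3.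
  move: #|A2 :\ x| #|A1 :\ x| #|A3| #|A2| #|A1| #|P x| => k2 k1 k3 ? ? p -> ->.
  by case: p => [|[|[|[|p]]]]; case: k3 => [|[|[|k3]]]; case: k2 => [|[|[|k2]]];
      case: k1 => [|[|[|k1]]].
have sub2 : A2 \subset A1 :\ x by rewrite subsetD1 s21.
have card1 : #|A1 :\ x| <= 3 by rewrite -ltnS -(D1 _ xA1) ltnW.
have ih := IH (A1 :\ x) A2 A3 s32 sub2 card1.
apply: leq_trans (bound _ _ _ _ (ih _ _) _) _.
- by move=> y; rewrite !inE => /andP[yx /ltx]; rewrite -(eqP xb) => /(_ yx).
- by move=> y z; rewrite !inE => /andP[_ yA] /andP[_ zA]; apply: A1c.
- apply/subsetP=> y; rewrite in_setU1 !in_setU => /orP[/orP[]|] /bigcupP[z zA yz].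
  + have [E|zx] := eqVneq z x; first by move: yz; rewrite E /= !inE orbF => ->.
    by rewrite (in_reachs 0 y z (A1 :\ x)) ?orbT // !inE zx.
  + by rewrite (in_reachs _ _ _ _ zA yz) !orbT.
  + by rewrite (in_reachs _ _ _ _ zA yz) !orbT.
by rewrite (D1 _ xA1) !addSn.
Qed.

Lemma reach3_card i : #|reach 3 i| <= 20.
Proof.
have := reach_levels (subxx (P i)) (subxx _) (P_card i) (@P_lt i) (@P_clique i).
have -> : reach 3 i = i |: reachs 2 (P i) by [].
move=> le; rewrite cardsU1.
have sub : reachs 2 (P i) \subset reachs 0 (P i) :|: reachs 1 (P i) :|: reachs 2 (P i) by
    apply: subsetUr.
have := subset_leq_card sub; move: le (P_card i); rewrite /weight2 /weight3.
move: #|_ :|: _| #|reachs _ _| #|P i| => u v p; case: (i \notin _) => /=;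
  by case: p => [|[|[|[|p]]]] //=; lia.
Qed.

Definition last_parent i := odflt i [pick j in P i | [forall k in P i, k <= j]].

Lemma last_parentP i j : j \in P i -> last_parent i \in P i /\ j <= last_parent i.
Proof.
move=> ji; rewrite /last_parent; case: pickP => [k /andP[ki /forall_inP km]|no];
    first by split=> //; apply: km.
case: (@arg_maxnP _ j (mem (P i)) val ji) => k ki km.
by have /negP[] := negbT (no k); apply/andP; split=> //; apply/forall_inP.
Qed.

(** Any other parent of [i] is a parent of the largest one by the clique property, so a first
    descent to it can be replaced by one from the largest parent, at no extra cost. *)
Lemma reach_last s i x : x \in reach s i -> x != i ->
  last_parent i \in P i /\ x \in reach s (last_parent i).
Proof.
case: s => [|s]; first by rewrite /= !inE orbF => /eqP-> /eqP.
move=> /reachSP[->|[j ji xj] _]; first by rewrite eqxx.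
have [lP le] := last_parentP ji; split=> //.
move: le; rewrite leq_eqVlt => /orP[/eqP/val_inj E|lt].
  by rewrite -E; apply: (subsetP (reach_leq j (leqnSn s))).
by apply: reachS_step xj; apply: P_clique ji lP lt.
Qed.

Definition bag_rel : rel 'I_n := fun i j =>
  (i != j) && [exists x, (i \in reach 3 x) && (j \in reach 3 x)].
Lemma bag_rel_sym : symmetric bag_rel.
Proof. by move=> i j; rewrite /bag_rel eq_sym; congr (_ && _); apply: eq_existsb => x;
    rewrite andbC. Qed.
Lemma bag_rel_irr : irreflexive bag_rel.
Proof. by move=> i; rewrite /bag_rel eqxx. Qed.
Definition bag_graph := @SGraph 'I_n bag_rel bag_rel_sym bag_rel_irr.

(** The bag of [x] is [reach 3 x], and the tree joins each part to its largest parent. A bag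
    containing [v] is linked to the bag of [v] by passing repeatedly to largest parents, all of
    whose bags contain [v] by [reach_last]. *)
Lemma bag_graph_tw : 0 < n -> tw_le bag_graph 19.
Proof.
move=> n0.
(* Parts without parents are attached to part 0, so that the forest of largest parents becomes one
   tree. *)
pose tp (i : 'I_n) : 'I_n := if P i == set0 then Ordinal n0 else last_parent i.
have tp_lt i : P i != set0 -> tp i < i.
  by move=> P0; rewrite /tp (negPf P0); have /set0Pn[j ji] := P0; apply: P_lt;
      have [] := last_parentP ji.
have tp_le (i : 'I_n) : tp i <= i.
  by have [E|/tp_lt/ltnW//] := eqVneq (P i) set0; rewrite /tp E eqxx.
have tp_lt' (i : 'I_n) : 0 < i -> tp i < i.
  by move=> i0; have [E|/tp_lt//] := eqVneq (P i) set0; rewrite /tp E eqxx.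
exists (parent_graph tp), (reach 3 : parent_graph tp -> {set bag_graph}); split;
    first exact: parent_tree.
split; first by move=> v; exists v; apply: reach_refl.
split; first by move=> u v /andP[_ /existsP[x /andP[ux vx]]]; exists x.
split; last exact: reach3_card.
move=> v; set r := (X in connect X).
have r_sym : symmetric r.
  by move=> a b; rewrite /r adj_sym [X in _ && X]andbC.
have tov (t : 'I_n) : v \in reach 3 t -> connect r t v.
  have [k] := ubnP (t : nat); elim: k t => // k IH t ltk vt.
  have [->|vt'] := eqVneq v t; first exact: connect0.
  have [lP vl] := reach_last vt vt'.
  have lt := P_lt lP.
  apply: connect_trans (IH (last_parent t) _ vl); last by lia.
  apply: connect1; rewrite /r vt vl !andbT.
  have P0 : P t != set0 by apply/set0Pn; exists (last_parent t).
  have -> : last_parent t = tp t by rewrite /tp (negPf P0).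
  by apply: parent_rel_tp => //; apply: leq_ltn_trans lt.
move=> t1 t2 /tov c1 /tov c2; apply: connect_trans c1 _.
by rewrite (sym_connect_sym r_sym).
Qed.

End Descent.

Lemma card_bigcup_le (I V : finType) (A : {pred I}) (F : I -> {set V}) k :
  (forall i, i \in A -> #|F i| <= k) -> #|\bigcup_(i in A) F i| <= #|A| * k.
Proof.
move=> Fk; rewrite -sum_nat_const.
elim/big_rec2: _ => [|i s B iA IH]; first by rewrite cards0.
by apply: leq_trans (leq_card_setU _ _) _; rewrite leq_add ?Fk.
Qed.

(** * Placing the vertices of a lift in bags, layer pairs and clusters *)

Section Lift.
Variables (d : nat) (G : sgraph) (M : G -> {set G}).
Hypothesis hM : clique_lift G d M.
Variables (n : nat) (pi dep : G -> nat) (par : nat -> seq nat).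
Hypothesis lay : layered_partition n pi dep par.

Let n_gt0 : 0 < n. Proof. by case: lay => -[]. Qed.
Let pi_lt u : pi u < n. Proof. by case: lay => -[_]. Qed.
Let dep_adj u v : adj u v -> dep u <= (dep v).+1. Proof. by case: lay => _ _ h _ _; apply: h. Qed.

Definition piO u : 'I_n := Ordinal (pi_lt u).
Definition parO (i : 'I_n) : {set 'I_n} := [set j : 'I_n | (j : nat) \in par i].

Lemma parO_lt (i j : 'I_n) : j \in parO i -> j < i.
Proof. by have [_ _ _ _ [_ h _]] := lay; rewrite inE; apply: h. Qed.

Lemma parO_clique (i p q : 'I_n) : p \in parO i -> q \in parO i -> p < q -> p \in parO q.
Proof. by have [_ _ _ _ [_ _ h]] := lay; rewrite !inE; apply: h. Qed.

Lemma parO_card i : #|parO i| <= 3.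
Proof.
have [_ _ _ _ [h _ _]] := lay; apply: leq_trans (h i).
rewrite cardE -(size_map val); apply: uniq_leq_size.
  by rewrite (map_inj_uniq val_inj) enum_uniq.
by move=> j /mapP[k]; rewrite mem_enum inE => kP ->.
Qed.

Local Notation reach := (reach parO).

Lemma le_reach1 u v : u = v \/ adj u v -> pi u <= pi v -> piO u \in reach 1 (piO v).
Proof.
move=> uv le; have [E|ne] := eqVneq (pi u) (pi v).
  have -> : piO u = piO v by apply: val_inj; rewrite /= E.
  exact: reach_refl.
have lt : pi u < pi v by rewrite ltn_neqAle ne.
case: uv => [E|uv]; first by rewrite E eqxx in ne.
apply: (@reachS_step _ _ 0 _ (piO u)); last exact: reach_refl.
have [_ h _ _ [_ hlt _]] := lay; rewrite inE /=.
case: (h u v uv) => [E|//|vu]; first by rewrite E eqxx in ne.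
by have := hlt _ _ (pi_lt u) vu; rewrite ltnNge le.
Qed.

Definition star w := [set v | (v == w) || (w \in M v)].
Definition apex w : G := [arg min_(v < w in star w) pi v].

Lemma apexP w : apex w \in star w /\ forall v, v \in star w -> pi (apex w) <= pi v.
Proof.
by rewrite /apex; case: arg_minnP => [|v vw vm]; [rewrite inE eqxx | split].
Qed.

Lemma M_adj v w : w \in M v -> adj v w.
Proof. by have [/subsetP h _] := hM v; move/h; rewrite inE. Qed.

Lemma star_adj v w : v \in star w -> v = w \/ adj v w.
Proof. by rewrite inE => /orP[/eqP|/M_adj]; [left | right]. Qed.

Lemma apex_le v w : v = w \/ w \in M v -> pi (apex w) <= pi v.
Proof.
by move=> h; apply: (apexP w).2; rewrite inE; case: h => [->|->]; rewrite ?eqxx ?orbT.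
Qed.

Lemma apex_reach w : piO (apex w) \in reach 1 (piO w).
Proof.
apply: le_reach1; last by apply: apex_le; left.
by apply: star_adj; case: (apexP w).
Qed.

Lemma reach_apex w i s : piO w \in reach s i -> piO (apex w) \in reach s.+1 i.
Proof.
elim: s i => [|s IH] i.
  by rewrite /= setU0 inE => /eqP <-; apply: apex_reach.
move=> /reachSP[<-|[j ji wj]]; last exact: reachS_step ji (IH _ wj).
by apply: (subsetP (reach_leq _ _ _)) (apex_reach w).
Qed.

Lemma reach_mono s t i x : s <= t -> x \in reach s i -> x \in reach t i.
Proof. by move=> st; apply/subsetP/reach_leq. Qed.

Lemma common_bag_adj u w : adj u w ->
  exists x, (piO (apex u) \in reach 3 x) && (piO (apex w) \in reach 3 x).
Proof.
wlog le : u w / pi u <= pi w => [H|uw].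
  case/orP: (leq_total (pi u) (pi w)) => le uw; first exact: H.
  by have [|x] := H w u le; [rewrite adj_sym | exists x; rewrite andbC].
exists (piO w); apply/andP; split; last exact: reach_mono (apex_reach w).
apply: (@reach_mono 2) => //; apply: reach_apex.
by apply: le_reach1 => //; right.
Qed.

(** The common part is that of the latest vertex among [v], [u], [w], or that of [u] if both [u] and
    [w] come after [v]. Three descents occur when [v] lies between the other two: one to [v], one to
    the vertex before it, one to the apex of that vertex. *)
Lemma common_bag_lift v u w : w \in M v -> adj v u ->
  exists x, (piO (apex u) \in reach 3 x) && (piO (apex w) \in reach 3 x).
Proof.
move=> wM vu; have vw := M_adj wM.
have le1 a b : adj a b -> pi a <= pi b -> piO a \in reach 1 (piO b).
  by move=> ab; apply: le_reach1; right.
have [leuv|ltvu] := leqP (pi u) (pi v).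
  have uv1 : piO u \in reach 1 (piO v) by apply: le1; rewrite // adj_sym.
  have [lewv|ltvw] := leqP (pi w) (pi v).
    exists (piO v); apply/andP; split; apply: (@reach_mono 2) => //; apply: reach_apex => //.
    by apply: le1; rewrite // adj_sym.
  exists (piO w); apply/andP; split; last exact: reach_mono (apex_reach w).
  apply: reach_closed (le1 v w vw (ltnW ltvw)) _; exact: reach_apex.
have vu1 := le1 v u vu (ltnW ltvu).
have [lewv|ltvw] := leqP (pi w) (pi v).
  exists (piO u); apply/andP; split; first exact: reach_mono (apex_reach u).
  apply: reach_closed vu1 _; apply: reach_apex; apply: le1 => //; by rewrite adj_sym.
exists (piO u); apply/andP; split; first exact: reach_mono (apex_reach u).
(* Both [u] and [w] come after [v]. The apex of [w] is no later than [v], and the parts of both are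
   parents of that of [w]; by the clique property the part of the apex is that of [v] or one of its
   parents. *)
apply: (@reach_mono 2) => //; apply: reach_closed vu1 _.
have letop : pi (apex w) <= pi v by apply: apex_le; right.
have lttop := leq_ltn_trans letop ltvw.
have [E|ne] := eqVneq (pi (apex w)) (pi v).
  have -> : piO (apex w) = piO v by apply: val_inj; rewrite /= E.
  exact: reach_refl.
have inP a : piO a \in reach 1 (piO w) -> pi a < pi w -> piO a \in parO (piO w).
  move=> /reachSP[E|[j jw]]; first by rewrite -[pi a]/(val (piO a)) E ltnn.
  by rewrite /= setU0 inE => /eqP ->.
apply: (@reachS_step _ _ 0 _ (piO (apex w))); last exact: reach_refl.
apply: parO_clique (inP _ (apex_reach w) lttop) (inP _ _ ltvw) _.
  exact: le1 (ltnW ltvw).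
by rewrite /= ltn_neqAle ne.
Qed.

Lemma common_bag u w : @adj (lift_graph G M) u w ->
  exists x, (piO (apex u) \in reach 3 x) && (piO (apex w) \in reach 3 x).
Proof.
case/andP=> _ /orP[/common_bag_adj //|/existsP[v /orP[]/andP[m a]]].
  by have [x] := common_bag_lift m a; exists x; rewrite andbC.
exact: common_bag_lift m a.
Qed.

Lemma dep_lift u w : @adj (lift_graph G M) u w -> dep u <= (dep w).+2.
Proof.
have adj2 v x y : adj v x -> adj v y -> dep x <= (dep y).+2.
  by move=> vx vy; have := dep_adj vy; rewrite adj_sym in vx; have := dep_adj vx; lia.
case/andP=> _ /orP[/dep_adj/leqW //|/existsP[v /orP[]/andP[/M_adj m a]]]; exact: (adj2 v).
Qed.

Definition layer_pair (u : G) := dep u %/ 2.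
Definition cluster (u : G) := [set w | (apex w \in [set v | pi v == pi (apex u)]) &&
    (layer_pair w == layer_pair u)].

(* Every [w] in the cluster lies in [v |: M v] for [v = apex w]; these [v] belong to
   one part and to four consecutive layers, so there are at most 12 of them. *)
Lemma cluster_card u : #|cluster u| <= 27 * d.+1.
Proof.
(* With [q] the layer pair, [w] is in layer 2q or 2q + 1 and its apex at most one layer away, so
   layers 2q - 1 to 2q + 2 suffice. At q = 0 the predecessor truncates and layer 0 is listed twice,
   which does no harm. *)
pose Z := \bigcup_(i : 'I_4)
  [set v | (pi v == pi (apex u)) && (dep v == (2 * layer_pair u + i).-1)].
have Z12 : #|Z| <= 12.
  have [_ _ _ h _] := lay.
  apply: leq_trans (card_bigcup_le (k := 3) _) _; last by rewrite card_ord.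
  by move=> i _; apply: h.
have sub : cluster u \subset \bigcup_(v in Z) (v |: M v).
  apply/subsetP=> w; rewrite !inE => /andP[tw /eqP rw].
  have [ts _] := apexP w; apply/bigcupP; exists (apex w); last first.
    by move: ts; rewrite !inE eq_sym.
  have close : dep (apex w) <= (dep w).+1 /\ dep w <= (dep (apex w)).+1.
    case: (star_adj ts) => [->|a]; first by split; apply: leqW.
    by split; apply: dep_adj; rewrite // adj_sym.
  have lt4 : (dep (apex w)).+1 - 2 * layer_pair u < 4 by move: rw close; rewrite /layer_pair; lia.
  apply/bigcupP; exists (Ordinal lt4) => //; rewrite inE tw /=.
  by move: rw close; rewrite /layer_pair; lia.
apply: leq_trans (subset_leq_card sub) _.
apply: leq_trans (card_bigcup_le (k := d.+1) _) _.
  move=> v _; rewrite cardsU1; have [_ Md] := hM v.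
  by apply: leq_trans (leq_add (leq_b1 _) Md) _.
by apply: leq_mul => //; apply: leq_trans Z12 _.
Qed.

Lemma cluster_refl u : u \in cluster u.
Proof. by rewrite !inE !eqxx. Qed.

Lemma cluster_index u : index u (enum (cluster u)) < 27 * d.+1.
Proof.
apply: leq_trans (cluster_card u); rewrite cardE index_mem mem_enum; exact: cluster_refl.
Qed.

Lemma layer_pair_lt u : layer_pair u < (\max_v dep v).+1.
Proof.
rewrite ltnS; apply: leq_trans (leq_div _ _) _; exact: (@leq_bigmax _ dep u).
Qed.

Lemma lift_contained : exists (H : sgraph) (k : nat),
  tw_le H 19 /\ contained (lift_graph G M)
    (sprod (sprod H (path_graph k)) (complete_graph (27 * d.+1))).
Proof.
exists (bag_graph parO), (\max_v dep v).+1; split.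
  apply: bag_graph_tw n_gt0.
  - exact: parO_card.
  - exact: parO_lt.
  - exact: parO_clique.
pose f (u : lift_graph G M) :
    sprod (sprod (bag_graph parO) (path_graph (\max_v dep v).+1)) (complete_graph (27 * d.+1)) :=
  ((piO (apex u), Ordinal (layer_pair_lt u)), Ordinal (cluster_index u)).
have f_inj : injective f.
  move=> u w [pt rw]; have -> : cluster u = cluster w by apply/setP=> x; rewrite !inE pt rw.
  move=> E; have uw : u \in cluster w by rewrite !inE pt rw !eqxx.
  rewrite -(nth_index u (_ : u \in enum (cluster w))) ?mem_enum // E nth_index // mem_enum.
  exact: cluster_refl.
exists f; split=> // u w uw.
have fuw : f u != f w.
  by apply: contraTneq uw => /f_inj ->; rewrite adj_irr.
apply/andP; split; last by rewrite /= /complete_rel orbN.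
rewrite fuw /=; case: eqP => //= ne; rewrite /sprod_rel /=; apply/andP; split.
  apply/andP; split; first exact/eqP.
  case: eqVneq => //= ne'; rewrite /bag_rel ne' /=.
  by have [x] := common_bag uw; move=> xx; apply/existsP; exists x.
have := dep_lift uw; have wu : @adj (lift_graph G M) w u by rewrite adj_sym.
have := dep_lift wu; rewrite -val_eqE /= /path_rel /= /layer_pair; lia.
Qed.

End Lift.

(** * From a product with a complete graph to row treewidth *)

Lemma tw_blowup (H : sgraph) k m : 0 < m -> tw_le H k ->
  tw_le (sprod H (complete_graph m)) (k.+1 * m - 1).
Proof.
move=> m0 [T [B [tT [cov [edg [cn sz]]]]]].
exists T, (fun t => [set x : sprod H (complete_graph m) | x.1 \in B t]); split=> //.
split; first by move=> [v i]; have [t vt] := cov v; exists t; rewrite inE.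
split.
  move=> [v i] [w j] /andP[/andP[_ /=]] /orP[/eqP E|vw] _.
    by have [t vt] := cov v; exists t; rewrite !inE /= -E.
  by have [t [vt wt]] := edg v w vw; exists t; rewrite !inE.
split.
  move=> [v i] t1 t2; rewrite !inE /= => h1 h2; have := cn v t1 t2 h1 h2.
  by apply: connect_sub => a b h; apply: connect1; rewrite !inE.
move=> t.
have -> : [set x : sprod H (complete_graph m) | x.1 \in B t] = setX (B t) setT.
  by apply/setP=> -[v i]; rewrite !inE andbT.
rewrite cardsX cardsT card_ord subn1 prednK ?muln_gt0 //.
by rewrite leq_mul2r sz orbT.
Qed.

Lemma rtw_of_sprod (L H : sgraph) n k m : 0 < m -> tw_le H k ->
  contained L (sprod (sprod H (path_graph n)) (complete_graph m)) ->
  rtw_le L (k.+1 * m - 1).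
Proof.
move=> m0 tH [f [f_inj f_adj]].
exists (sprod H (complete_graph m)), n; split; first exact: tw_blowup.
exists (fun x => (((f x).1.1, (f x).2), (f x).1.2)); split.
  move=> x y [e1 e2 e3]; apply: f_inj; move: e1 e2 e3.
  by case: (f x) (f y) => [[a b] c] [[a' b'] c'] /= -> -> ->.
move=> x y /f_adj; case: (f x) (f y) => [[a b] c] [[a' b'] c'].
rewrite /= /sprod_rel /= /sprod_rel /= !xpair_eqE.
by case: (a == a'); case: (b == b'); case: (c == c'); case: (adj a a');
  case: (path_rel _ _ _); case: (complete_rel _ _ _).
Qed.

Theorem theorem24 (d : nat) (G : sgraph) (M : G -> {set G})
  (hd : 1 <= d) (hG : planar G) (hM : clique_lift G d M) :
  (exists (H : sgraph) (n : nat),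
      tw_le H 19 /\
      contained (lift_graph G M)
        (sprod (sprod H (path_graph n)) (complete_graph (27 * d.+1))))
  /\ rtw_le (lift_graph G M) (540 * d.+1 - 1).
Proof.
have [n [pi [dep [par lay]]]] := planar_partition hG.
have [H [k [twH cH]]] := lift_contained hM lay.
split; first by exists H, k.
have -> : 540 * d.+1 = 20 * (27 * d.+1) by rewrite mulnA.
exact: rtw_of_sprod twH cH.
Qed.
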